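(* Let $\lambda\in(0,\infty)$, let $\theta\in\mathbb{R}$, set $\beta=\beta_n=\tfrac13+\frac{\theta}{\log n}$, and let $\mathbb{P}_\beta$ be the exponential random graph law on graphs with vertex set $[n]$ given by $$\frac{d\mathbb{P}_\beta}{d\mathbb{P}}(G_n)=\frac{1}{Z_n(\beta)}\,\mathrm{e}^{\beta\log n\,V_T(G_n)},$$ where $\mathbb{P}$ is the law of the Erdős–Rényi random graph $G(n,\lambda/n)$ and $Z_n(\beta)$ is the normalising constant. Then $$\lim_{n\to\infty}\frac1n\log Z_n(\beta)=\max_{a\in[0,1]}\Lambda(a,\theta,\lambda),$$ where $$\Lambda(a,\theta,\lambda)=\theta a-(1-a)\log(1-a)-(\tfrac13a)\log(\tfrac13a)-\tfrac23a-\tfrac13a\log6+a\log\lambda.$$ Furthermore, $\Lambda(\cdot,\theta,\lambda)$ has a unique maximizer $a^\star$ on $[0,1]$, and, in probability under $\mathbb{P}_\beta$ as $n\to\infty$, $$\frac{V_T(G_n)}{n}\to a^\star\qquad\text{and}\qquad\frac{E(G_n)}{n}\to\frac{\lambda}{2}+a^\star.$$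
   Context: $G(n,p)$ is the random simple graph on vertex set $[n]=\{1,\dots,n\}$ in which each possible edge is present independently with probability $p$. For a graph $G$, $V_T(G)$ is the number of vertices of $G$ that belong to at least one triangle of $G$, and $E(G)$ (in the quotient $E(G_n)/n$) denotes the number of edges of $G$. Convention: $0\log0=0$. *)

(* Defs.v *)
From HB Require Import structures.
From mathcomp Require Import all_boot all_order all_algebra.
From mathcomp Require Import all_classical all_reals all_analysis.

Set Implicit Arguments.
Unset Strict Implicit.
Unset Printing Implicit Defensive.

Import Order.TTheory GRing.Theory Num.Theory.
Import numFieldNormedType.Exports.

Local Open Scope classical_set_scope.
Local Open Scope ring_scope.

Definition edge (n : nat) : finType := {e : {set 'I_n} | #|e| == 2}.

Definition graph (n : nat) : finType := {set edge n}.

Definition adj (n : nat) (G : graph n) (i j : 'I_n) : bool :=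
  [exists e in G, val e == [set i; j]%SET].

Definition num_edges (n : nat) (G : graph n) : nat := #|G|.

(* Distinctness of i, j, k is automatic: [adj] is irreflexive since edges are
   two-element sets. *)
Definition in_triangle (n : nat) (G : graph n) (i : 'I_n) : bool :=
  [exists j, exists k, [&& adj G i j, adj G j k & adj G i k]].

Definition V_T (n : nat) (G : graph n) : nat := #|[pred i | in_triangle G i]|.

(* A law on graphs is given by its mass function. *)
Definition prob (R : realType) (n : nat) (mu : graph n -> R)
    (A : pred (graph n)) : R :=
  \sum_(G : graph n | A G) mu G.

(* This is a probability mass function only for 0 <= p <= 1.  With p = lambda/n
   this holds once n >= lambda and n >= 1, and the values at smaller n do not
   affect limits as n tends to infinity. *)
Definition ER_law (R : realType) (n : nat) (p : R) (G : graph n) : R :=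
  \prod_(e : edge n) (if e \in G then p else 1 - p).

(* exp (beta log n V_T(G)) *)
Definition tilt (R : realType) (n : nat) (beta : R) (G : graph n) : R :=
  expR (beta * ln n%:R * (V_T G)%:R).

Definition Z (R : realType) (lambda : R) (n : nat) (beta : R) : R :=
  \sum_(G : graph n) tilt beta G * ER_law (lambda / n%:R) G.

Definition ERGM_law (R : realType) (lambda : R) (n : nat) (beta : R)
    (G : graph n) : R :=
  (Z lambda n beta)^-1 * tilt beta G * ER_law (lambda / n%:R) G.

Definition beta_ (R : realType) (theta : R) (n : nat) : R :=
  3^-1 + theta / ln n%:R.

(* [ln 0 = 0], so 0 log 0 = 0 as required. *)
Definition Lambda (R : realType) (theta lambda a : R) : R :=
  theta * a - (1 - a) * ln (1 - a) - (a / 3) * ln (a / 3) - 2 / 3 * a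
  - a / 3 * ln 6 + a * ln lambda.

Definition is_maximizer (R : realType) (D : set R) (f : R -> R) (a : R) : Prop :=
  D a /\ forall b, D b -> f b <= f a.

Definition cvg_in_prob (R : realType) (mu : forall n, graph n -> R)
    (X : forall n, graph n -> R) (c : R) : Prop :=
  forall eps : R, 0 < eps ->
    (fun n : nat => prob (mu n) [pred G | eps < `|X n G - c|]) @ \oo --> (0 : R).

(* Main.v *)
Require Import Defs.
From HB Require Import structures.
From mathcomp Require Import all_boot all_order all_algebra.
From mathcomp Require Import all_classical all_reals all_analysis.
From mathcomp Require Import ring lra zify.
Import mathcomp.boot.fintype mathcomp.boot.finset.

Set Implicit Arguments.
Unset Strict Implicit.
Unset Printing Implicit Defensive.

Import Order.TTheory GRing.Theory Num.Theory.
Import numFieldNormedType.Exports.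

Local Open Scope ring_scope.

(** Write [y = exp (beta log n)], which is of order [n^(1/3)], and let
[partition_fun n p y] be the expectation of [y ^ V_T] under [G(n, p)].

A vertex-disjoint family (a packing) of [m] triangles contributes
[(p y) ^ (3 m)] to this expectation, and there are
[n! / (m! 6^m (n - 3 m)!)] such families ([card_packings]).  Since [p y] is of
order [n^(-2/3)], Stirling's formula turns the product into
[exp (n Lambda (3 m / n) + O(log n))] ([ln_packing_weight]).  All other ways of
covering vertices by triangles are subexponential.  A triangle that shares a
vertex with what is already covered and adds two vertices has total weight
[n^3 p^3 y^2 = O(n^(2/3))].  A triangle that adds one vertex has weight
[O(n^(1/3))].  For the vertices attached to an edge that is already used, the
weight [n . n . p^2 y] is again [O(n^(1/3))].  So the union bound over such
coverings gives [partition_fun_le]: the sum over packings times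
[exp (O(n^(2/3)))].

Conversely, given that a packing is present, the expected number of further
triangles is bounded, so with probability at least one half there are at most a
constant [K] of them, and a graph with [m + K] triangles contains only
polynomially many packings of size [m].  Counting pairs (graph, packing) gives
[partition_fun_ge] with a polynomial loss.  Together these bounds give the free
energy [free_energy_cvg], for any sequence [p_n] with [n p_n -> lambda].

The maximizer [a] of [Lambda] solves [theta + ln lambda = slope a], and the
difference [Lambda a - Lambda b] is a sum of two relative entropies
([Lambda_gap]), hence positive for [b] different from [a].

Concentration comes from exponential moments.  Replacing [theta] by [theta + t]
multiplies the weight by [exp (t V_T)].  Multiplying the weight by
[exp (t |E|)] amounts to replacing [lambda] by about [lambda exp t], up to a
factor [exp (n lambda (exp t - 1) / 2)] ([ER_law_edge_tilt]).  Both changes move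
[theta + ln lambda] by [t], so the free energy controls both moment generating
functions, and the bound of Chernoff concludes ([cvg_in_prob_of_mgf]). *)

(** * Finite sets and finite sums *)

Lemma bin_le_expn (n k : nat) : ('C(n, k) <= n ^ k)%N.
Proof.
apply: (@leq_trans (n ^_ k)); first by rewrite -bin_ffact leq_pmulr // fact_gt0.
rewrite ffact_prod -[X in (_ <= _ ^ X)%N]card_ord -prod_nat_const.
by apply: leq_prod => i _; exact: leq_subr.
Qed.

Lemma leq_expn2r (a b k : nat) : (a <= b)%N -> (a ^ k <= b ^ k)%N.
Proof. by case: k => [|k] ab; rewrite ?expn0 // leq_exp2r. Qed.

Lemma card_bigcup_disjoint (I T : finType) (F : I -> {set T}) :
  (forall i j, i != j -> [disjoint F i & F j]) ->
  #|\bigcup_i F i| = (\sum_i #|F i|)%N.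
Proof.
move=> dF; rewrite -sum1_card partition_disjoint_bigcup //.
by apply: eq_bigr => i _; rewrite sum1_card.
Qed.

Lemma card_bigcup_disjoint_in (I T : finType) (B : {set I}) (F : I -> {set T}) :
  (forall i j, i \in B -> j \in B -> i != j -> [disjoint F i & F j]) ->
  #|\bigcup_(i in B) F i| = (\sum_(i in B) #|F i|)%N.
Proof.
move=> dF; rewrite big_mkcond /= card_bigcup_disjoint; last first.
  move=> i j ij; case: ifP => iB; case: ifP => jB; rewrite ?disjoints0 ?disjoint0s //.
    exact: dF.
  - by rewrite -setI_eq0 setI0.
  - by rewrite -setI_eq0 set0I.
  - by rewrite -setI_eq0 set0I.
rewrite [RHS]big_mkcond /=; apply: eq_bigr => i _.
by case: ifP => //; rewrite cards0.
Qed.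

Lemma leq_card_bigcup (I T : finType) (S : {set I}) (F : I -> {set T}) :
  (#|\bigcup_(i in S) F i| <= \sum_(i in S) #|F i|)%N.
Proof.
elim/big_rec2: _ => [|i A k _ kA]; first by rewrite cards0.
by apply: leq_trans (leq_card_setU _ _) _; rewrite leq_add2l.
Qed.

Lemma sum_option (R : realType) (T : finType) (f : option T -> R) :
  \sum_(o : option T) f o = f None + \sum_(t : T) f (Some t).
Proof.
rewrite (bigD1 None) //=; congr (_ + _).
rewrite (reindex_omap Some id) /=; last by case.
by apply: eq_bigl => t; rewrite eqxx.
Qed.

(** The generating function of all subsets: it lets a union bound over sets of
objects cost only the exponential of the total weight of the objects. *)
Lemma sum_subsets_prod (R : realType) (T : finType) (W : {set T}) (w : T -> R) :
  \sum_(B : {set T} | B \subset W) \prod_(b in B) w b = \prod_(b in W) (1 + w b).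
Proof.
have -> : \prod_(b in W) (1 + w b) = \prod_b ((if b \in W then w b else 0) + 1).
  rewrite big_mkcond; apply: eq_bigr => b _.
  by case: ifP; rewrite ?add0r // addrC.
rewrite bigA_distr [RHS](bigID (fun B : {set T} => B \subset W)) /= [X in _ + X]big1 ?addr0.
  apply: eq_bigr => B /subsetP BW; rewrite big_mkcond /=.
  by apply: eq_bigr => b _; case: ifP => // /BW ->.
by move=> B /subsetPn[b bB bW]; rewrite (bigD1 b) //= bB (negPf bW) mul0r.
Qed.

Lemma prod_1D_le_expR (R : realType) (T : finType) (W : {set T}) (w : T -> R) (c : R) :
  (forall b, b \in W -> 0 <= w b <= c) ->
  \prod_(b in W) (1 + w b) <= expR (#|W|%:R * c).
Proof.
move=> wc; rewrite expRM_natl -prodr_const; apply: ler_prod => b /wc /andP[w0 wb].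
by rewrite addr_ge0 //=; apply: le_trans (expR_ge1Dx _); rewrite lerD2l.
Qed.

(** * The law of the random graph *)

Lemma ER_law_ge0 (R : realType) (n : nat) (p : R) (G : graph n) :
  0 <= p <= 1 -> 0 <= ER_law p G.
Proof.
move=> /andP[p0 p1]; apply: prodr_ge0 => e _.
by case: ifP => _ //; rewrite subr_ge0.
Qed.

(** The probability that all the edges of [S] are present, obtained by expanding
a product over the edges of [p + (1 - p)], in which the term [1 - p] is
suppressed on [S]. *)
Lemma sum_ER_law_superset (R : realType) (n : nat) (p : R) (S : graph n) :
  \sum_(G : graph n | S \subset G) ER_law p G = p ^+ #|S|.
Proof.
have -> : p ^+ #|S| =
    \prod_(e : edge n) (p + (if e \in S then 0 else 1 - p)).
  rewrite (bigID (mem S)) /= [X in _ * X]big1 ?mulr1; last first.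
    by move=> e /negPf ->; rewrite addrC subrK.
  rewrite (eq_bigr (fun=> p)) => [|e ->]; last by rewrite addr0.
  by rewrite prodr_const.
rewrite bigA_distr [RHS](bigID (fun G : graph n => S \subset G)) /=.
rewrite [X in _ = _ + X]big1 ?addr0 => [|G /subsetPn[e eS eG]]; last first.
  by rewrite (bigD1 e) //= (negPf eG) eS mul0r.
apply: eq_bigr => G /subsetP SG; apply: eq_bigr => e _.
case: ifP => // eG; case: ifP => // eS.
by rewrite SG in eG.
Qed.

Lemma sum_ER_law (R : realType) (n : nat) (p : R) :
  \sum_(G : graph n) ER_law p G = 1.
Proof.
have := sum_ER_law_superset p (set0 : graph n).
by rewrite cards0 expr0 => <-; apply: eq_bigl => G; rewrite sub0set.
Qed.

Lemma edge_card (n : nat) (e : edge n) : #|val e| = 2%N.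
Proof. exact: (eqP (valP e)). Qed.

Lemma card_edge (n : nat) : #|edge n| = 'C(n, 2).
Proof.
rewrite card_sig -[X in 'C(X, 2)]card_ord -card_draws.
by apply: eq_card => e; rewrite !inE.
Qed.

(** A weight [u] per edge changes the odds [p / (1 - p)] of each edge into
[p u / (1 - p)], so it amounts to another Erdős–Rényi law, up to a constant. *)
Lemma ER_law_edge_tilt (R : realType) (n : nat) (p u : R) (G : graph n) :
  1 - p + p * u != 0 ->
  u ^+ num_edges G * ER_law p G =
  (1 - p + p * u) ^+ 'C(n, 2) * ER_law (p * u / (1 - p + p * u)) G.
Proof.
move=> q0; set q := 1 - p + p * u.
have -> : u ^+ num_edges G = \prod_(e : edge n) (if e \in G then u else 1).
  by rewrite -big_mkcond /= prodr_const.
rewrite -card_edge -prodr_const -!big_split /=; apply: eq_bigr => e _.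
by case: ifP => _; rewrite /q; field.
Qed.

Definition partition_fun (R : realType) (n : nat) (p y : R) : R :=
  \sum_(G : graph n) y ^+ V_T G * ER_law p G.

(** The expectation of a variable which is at least [1]. *)
Lemma partition_fun_ge1 (R : realType) (n : nat) (p y : R) :
  0 <= p -> p <= 1 -> 1 <= y -> 1 <= partition_fun n p y.
Proof.
move=> p0 p1 y1; rewrite -[leLHS](sum_ER_law n p); apply: ler_sum => G _.
by rewrite -[leLHS]mul1r ler_wpM2r ?ER_law_ge0 ?p0 // exprn_ege1.
Qed.

Lemma ZE (R : realType) (lambda beta : R) (n : nat) :
  Z lambda n beta = partition_fun n (lambda / n%:R) (expR (beta * ln n%:R)).
Proof. by apply: eq_bigr => G _; rewrite /tilt expRM_natr. Qed.

(** * Triangles *)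

Definition edges_in (n : nat) (A : {set 'I_n}) : graph n :=
  [set e : edge n | val e \subset A].

Lemma card_edges_in (n : nat) (A : {set 'I_n}) : #|edges_in A| = 'C(#|A|, 2).
Proof.
rewrite -cards_draws -(card_imset _ val_inj); apply: eq_card => e.
apply/imsetP/idP => [[e' + ->]|]; rewrite !inE.
  by move=> ->; exact: (valP e').
by move=> /andP[eA e2]; exists (Sub e e2); rewrite ?inE.
Qed.

Lemma edges_in_disjoint (n : nat) (A B : {set 'I_n}) :
  (#|A :&: B| <= 1)%N -> [disjoint edges_in A & edges_in B].
Proof.
move=> AB; rewrite -setI_eq0; apply/eqP/setP => e; rewrite !inE.
apply/negP => /andP[eA eB]; move: AB; rewrite leqNgt => /negP; apply.
rewrite -(edge_card e); apply: subset_leq_card.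
by apply/subsetIP.
Qed.

Definition triangles (n : nat) (G : graph n) : {set {set 'I_n}} :=
  [set T : {set 'I_n} | (#|T| == 3%N) && (edges_in T \subset G)].

Lemma adjP (n : nat) (G : graph n) (i j : 'I_n) :
  reflect (exists2 e, e \in G & val e = [set i; j]) (adj G i j).
Proof.
by apply: (iffP existsP) => [[e /andP[eG /eqP]]|[e eG /eqP]];
   exists e; rewrite // eG.
Qed.

Lemma adj_neq (n : nat) (G : graph n) (i j : 'I_n) : adj G i j -> i != j.
Proof.
by move=> /adjP[e _ eE]; have := edge_card e; rewrite eE cards2; case: (i != j).
Qed.

Lemma in_triangleP (n : nat) (G : graph n) (i : 'I_n) :
  reflect (exists2 T, T \in triangles G & i \in T) (in_triangle G i).
Proof.
apply: (iffP existsP) => [[j /existsP[k /and3P[ij jk ik]]]|[T]].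
  exists [set i; j; k]; rewrite !inE ?eqxx //.
  have nij := adj_neq ij; have njk := adj_neq jk; have nik := adj_neq ik.
  have c3 : #|[set i; j; k]| = 3%N.
    by rewrite setUC cardsU1 cards2 !inE nij negb_or eq_sym nik eq_sym njk.
  rewrite c3 /=; apply/subsetP => e; rewrite inE => /subsetP eT.
  have /cards2P[x [y [xy eE]]] : #|val e| == 2%N by rewrite edge_card.
  have mk (a b : 'I_n) : adj G a b -> val e = [set a; b] -> e \in G.
    by move=> /adjP[e' e'G e'E] eE'; rewrite (_ : e = e') //; apply: val_inj; rewrite eE' e'E.
  have /eT xT : x \in val e by rewrite eE !inE eqxx.
  have /eT yT : y \in val e by rewrite eE !inE eqxx orbT.
  move: xT yT xy eE; rewrite !inE -!orbA.
  by move=> /or3P[] /eqP-> /or3P[] /eqP-> //; rewrite ?eqxx // => _ eE;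
    first [exact: (mk _ _ ij) | exact: (mk _ _ jk) | exact: (mk _ _ ik)
      | by apply: (mk _ _ ij); rewrite eE setUC
      | by apply: (mk _ _ jk); rewrite eE setUC
      | by apply: (mk _ _ ik); rewrite eE setUC].
rewrite inE => /andP[/eqP c3 /subsetP TG] iT.
have : #|T :\ i| == 2%N by have := cardsD1 i T; rewrite c3 iT add1n => -[<-].
move=> /cards2P[j [k [jk TE]]].
have := setD1K iT; rewrite TE => TE'.
have ij : i != j by apply/eqP => ij; have := setD11 i T; rewrite TE !inE ij eqxx.
have ik : i != k by apply/eqP => ik; have := setD11 i T; rewrite TE !inE ik eqxx orbT.
have mk (a b : 'I_n) : a != b -> a \in T -> b \in T -> adj G a b.
  move=> ab aT bT; have e2 : #|[set a; b]| == 2%N by rewrite cards2 ab.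
  apply/adjP; exists (Sub [set a; b] e2) => //; apply: TG; rewrite inE /=.
  by apply/subsetP => z; rewrite !inE => /orP[] /eqP ->.
exists j; apply/existsP; exists k; rewrite !mk // -TE' !inE !eqxx ?orbT //.
Qed.

(** * Counting packings of triples *)

Definition triples (V : finType) (A : {set V}) : {set {set V}} :=
  [set T : {set V} | (T \subset A) && (#|T| == 3%N)].

Lemma card_triples (V : finType) (A : {set V}) : #|triples A| = 'C(#|A|, 3).
Proof. by rewrite -cards_draws; apply: eq_card => T; rewrite !inE. Qed.

Lemma card_triples_le (n : nat) : (#|triples [set: 'I_n]| <= n ^ 3)%N.
Proof. by rewrite card_triples cardsT card_ord bin_le_expn. Qed.

Definition packings (V : finType) (A : {set V}) (m : nat) : {set {set {set V}}} :=
  [set D | [&& trivIset D, D \subset triples A & #|D| == m]].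

Lemma card_packing_cover (V : finType) (A : {set V}) (m : nat) (D : {set {set V}}) :
  D \in packings A m -> #|cover D| = (3 * m)%N.
Proof.
rewrite inE => /and3P[/eqP <- /subsetP D3 /eqP <-].
rewrite mulnC -sum_nat_const; apply: eq_bigr => T /D3.
by rewrite inE => /andP[_ /eqP].
Qed.

Lemma card_packings_with (V : finType) (A : {set V}) (m : nat) (T : {set V}) :
  T \in triples A ->
  #|[set D in packings A m.+1 | T \in D]| = #|packings (A :\: T) m|.
Proof.
rewrite inE => /andP[TA /eqP T3].
have nT (D : {set {set V}}) : D \subset triples (A :\: T) -> T \notin D.
  move=> /subsetP DA; apply/negP => /DA; rewrite inE => /andP[/subsetDP[_]].
  by rewrite -setI_eq0 setIid -cards_eq0 T3.
rewrite -(card_in_imset (f := fun D => T |: D) (D := packings (A :\: T) m));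
  last first.
  move=> D D'; rewrite !inE => /and3P[_ DA _] /and3P[_ DA' _] /= E.
  by rewrite -(setU1K (nT _ DA)) E setU1K // nT.
apply: eq_card => D; apply/idP/imsetP => [|[D' + ->]]; rewrite !inE.
  move=> /andP[/and3P[tD DA /eqP cD] TD]; exists (D :\ T); rewrite ?setD1K //.
  have cD' : #|D :\ T| = m by have := cardsD1 T D; rewrite cD TD add1n => -[<-].
  rewrite inE cD' eqxx andbT.
  rewrite (trivIsetS (subD1set _ _) tD) /=; apply/subsetP => U.
  rewrite !inE => /andP[UT UD]; have := subsetP DA _ UD; rewrite inE => /andP[UA ->].
  rewrite andbT subsetD UA /=; exact: (trivIsetP tD).
move=> /and3P[tD DA /eqP cD]; rewrite eqxx /= andbT cardsU1 nT // cD eqxx andbT.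
have dT U : U \in D' -> [disjoint T & U].
  by move=> /(subsetP DA); rewrite inE subsetD disjoint_sym => /andP[/andP[]].
apply/andP; split.
  apply/trivIsetP => U U'; rewrite !inE.
  move=> /orP[/eqP->|UD] /orP[/eqP->|UD']; rewrite ?eqxx // => UU'.
  - exact: dT.
  - by rewrite disjoint_sym; exact: dT.
  - exact: (trivIsetP tD).
rewrite subUset sub1set !inE TA T3 eqxx; apply: subset_trans DA _.
by apply/subsetP => U; rewrite !inE subsetD => /andP[/andP[-> _] ->].
Qed.

(** Double counting of the pairs of a packing of size [m + 1] and one of its
triples; removing the triple leaves a packing of the remaining points. *)
Lemma card_packings_rec (V : finType) (A : {set V}) (m : nat) :
  (m.+1 * #|packings A m.+1| = \sum_(T in triples A) #|packings (A :\: T) m|)%N.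
Proof.
rewrite mulnC -sum_nat_const.
have -> : (\sum_(D in packings A m.+1) m.+1 =
           \sum_(D in packings A m.+1) \sum_(T in D) 1)%N.
  by apply: eq_bigr => D; rewrite inE => /and3P[_ _ /eqP <-]; rewrite sum1_card.
rewrite (exchange_big_dep (mem (triples A))) /=; last first.
  by move=> D T; rewrite inE => /and3P[_ /subsetP DA _]; exact: DA.
apply: eq_bigr => T TA; rewrite -card_packings_with // -sum1_card.
by apply: eq_bigl => D; rewrite !inE.
Qed.

(** The number of packings is the multinomial number
[n! / (m! 6^m (n - 3 m)!)]; stated as a product to stay within natural
numbers. *)
Lemma card_packings (V : finType) (A : {set V}) (m : nat) :
  (3 * m <= #|A|)%N ->
  (#|packings A m| * m`! * 6 ^ m * (#|A| - 3 * m)`! = (#|A|)`!)%N.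
Proof.
elim: m A => [|m IH] A mA.
  rewrite muln0 subn0 expn0 !muln1.
  rewrite (_ : packings A 0 = [set set0]) ?cards1 ?mul1n //.
  apply/setP => D; rewrite !inE cards_eq0; case: eqP => [->|]; rewrite ?andbF //.
  by rewrite sub0set /trivIset /cover !big_set0 cards0.
have A3 : (3 <= #|A|)%N by lia.
have E T : T \in triples A ->
    (#|packings (A :\: T) m| * m`! * 6 ^ m * (#|A| - 3 * m.+1)`! = (#|A| - 3)`!)%N.
  rewrite inE => /andP[TA /eqP T3].
  have cAT : #|A :\: T| = (#|A| - 3)%N by rewrite cardsD (setIidPr TA) T3.
  rewrite -cAT -IH ?cAT; last by lia.
  by congr (_ * _`!)%N; lia.
(* The factor [6 = 3!] completes the number of triples to a falling factorial. *)
transitivity (6 * ((m.+1 * #|packings A m.+1|) *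
    (m`! * 6 ^ m * (#|A| - 3 * m.+1)`!)))%N; first by rewrite factS expnS; ring.
rewrite card_packings_rec big_distrl /=.
rewrite (eq_bigr (fun=> (#|A| - 3)`!)) => [|T TA]; last by rewrite !mulnA E.
rewrite sum_nat_const.
rewrite card_triples.
rewrite -(bin_fact A3) /=; rewrite (_ : 3`! = 6)%N //; lia.
Qed.

Lemma card_packings0 (V : finType) (A : {set V}) (m : nat) :
  (#|A| < 3 * m)%N -> #|packings A m| = 0%N.
Proof.
move=> mA; apply/eqP; rewrite cards_eq0; apply/eqP/setP => D; rewrite [RHS]inE.
apply/negP => DP; have := card_packing_cover DP; move: DP; rewrite inE.
move=> /and3P[_ /subsetP DA _]; suff : (#|cover D| <= #|A|)%N by lia.
apply: subset_leq_card; apply/bigcupsP => T /DA.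
by rewrite inE => /andP[].
Qed.

(** * Covering the vertices of triangles *)

(** A gadget [(T, V)] is a triangle [T] together with the set [V] of vertices of
[T] that it is used to cover; the other vertices of [T] are covered by other
gadgets. *)
Definition gadget (n : nat) : finType := ({set 'I_n} * {set 'I_n})%type.

Definition covered (n : nat) (B : {set gadget n}) : {set 'I_n} :=
  \bigcup_(b in B) b.2.

Definition used_edges (n : nat) (B : {set gadget n}) : graph n :=
  \bigcup_(b in B) edges_in b.1.

(** The vertices covered and the edges used by different gadgets are disjoint, so
that the weight [p ^ (number of edges) * y ^ (number of vertices)] of a system
is the product of the weights of its gadgets.  As the triangles lie within
[covered B], no used edge touches an uncovered vertex. *)
Definition gadget_system (n : nat) (B : {set gadget n}) : bool :=
  [forall b in B, [&& #|b.1| == 3%N, b.2 \subset b.1, b.2 != set0 & b.1 \subset covered B]]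
  && [forall b in B, forall b' in B, (b != b') ==>
       [disjoint b.2 & b'.2] && [disjoint edges_in b.1 & edges_in b'.1]].

(** When [w] is not an end of [e], these are the two edges that join [w] to the
ends of [e]. *)
Definition star (n : nat) (w : 'I_n) (e : edge n) : graph n :=
  [set e' : edge n | (w \in val e') && (val e' \subset w |: val e)].

Lemma gadget_systemP (n : nat) (B : {set gadget n}) :
  reflect [/\ forall b, b \in B ->
                [/\ #|b.1| = 3%N, b.2 \subset b.1, b.2 != set0 & b.1 \subset covered B],
              forall b b', b \in B -> b' \in B -> b != b' -> [disjoint b.2 & b'.2] &
              forall b b', b \in B -> b' \in B -> b != b' ->
                [disjoint edges_in b.1 & edges_in b'.1]]
          (gadget_system B).
Proof.
apply: (iffP andP) => [[/forall_inP B1 /forall_inP B2]|[B1 B2 B3]].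
  split=> [b /B1 /and4P[/eqP]|b b' bB b'B bb'|b b' bB b'B bb'] //.
    by have /forall_inP/(_ _ b'B)/implyP/(_ bb')/andP[] := B2 _ bB.
  by have /forall_inP/(_ _ b'B)/implyP/(_ bb')/andP[] := B2 _ bB.
split; apply/forall_inP => b bB; first by have [/eqP-> -> ->] := B1 _ bB.
by apply/forall_inP => b' b'B; apply/implyP => bb'; rewrite B2 ?B3.
Qed.

Lemma used_edge_covered (n : nat) (B : {set gadget n}) (e : edge n) :
  gadget_system B -> e \in used_edges B -> val e \subset covered B.
Proof.
move=> /gadget_systemP[B1 _ _] /bigcupP[b bB]; rewrite inE => eb.
by have [_ _ _] := B1 _ bB; exact: subset_trans.
Qed.

(** Take a system in [G] that covers as many vertices as possible.  If a triangle
[T] through an uncovered vertex [w] used only new edges, the gadget that covers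
all the uncovered vertices of [T] could be added.  So [T] contains a used edge,
and then [w] forms a triangle with that edge. *)
Lemma exists_gadget_cover (n : nat) (G : graph n) :
  exists B : {set gadget n}, [/\ gadget_system B, used_edges B \subset G &
    forall w, in_triangle G w -> w \notin covered B ->
      exists2 e, e \in used_edges B & star w e \subset G].
Proof.
pose P (B : {set gadget n}) := gadget_system B && (used_edges B \subset G).
have P0 : P set0.
  rewrite /P /used_edges big_set0 sub0set andbT; apply/gadget_systemP.
  by split=> b; rewrite ?inE // => b'; rewrite inE.
case: (arg_maxnP (fun B => #|covered B|) P0) => B /andP[BS BG] maxB.
exists B; split=> // w /in_triangleP[T TG wT] wC.
move: TG; rewrite inE => /andP[/eqP T3 TG].
have [BS1 BS2 BS3] := gadget_systemP _ BS.
pose b : gadget n := (T, T :\: covered B).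
have bB : b \notin B.
  apply: contra (wC) => bB; apply/bigcupP; exists b => //=.
  by rewrite inE wC.
have covB' : covered (b |: B) = covered B :|: T.
  rewrite /covered bigcup_setU big_set1 /= -/(covered B).
  by apply/setP => x; rewrite !inE orbC; case: (x \in covered B).
have [dTS|] := boolP [disjoint edges_in T & used_edges B].
  have PB' : P (b |: B).
    apply/andP; split; last first.
      rewrite /used_edges bigcup_setU big_set1 subUset TG; exact: BG.
    apply/gadget_systemP; rewrite covB'; split.
    - move=> c /setU1P[->/=|/BS1[c1 c2 c3 c4]].
        split=> //; rewrite ?subsetDl ?subsetUr //.
        by apply/set0Pn; exists w; rewrite inE wC.
      by split=> //; apply: subset_trans c4 (subsetUl _ _).
    - have H c : c \in B -> [disjoint b.2 & c.2].
        move=> cB; rewrite -setI_eq0; apply/eqP/setP => x; rewrite !inE.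
        apply/negP => /andP[/andP[/negP xC _] xc]; apply: xC.
        by apply/bigcupP; exists c.
      move=> c c' /setU1P[->|cB] /setU1P[->|c'B]; rewrite ?eqxx // => cc'.
      + exact: H.
      + by rewrite disjoint_sym H.
      + exact: BS2.
    - have H c : c \in B -> [disjoint edges_in b.1 & edges_in c.1].
        by move=> cB; apply: disjointWr dTS; apply: bigcup_sup cB.
      move=> c c' /setU1P[->|cB] /setU1P[->|c'B]; rewrite ?eqxx // => cc'.
      + exact: H.
      + by rewrite disjoint_sym H.
      + exact: BS3.
  have lt : (#|covered B| < #|covered (b |: B)|)%N.
    rewrite covB'; apply: proper_card; rewrite properE subsetUl /=.
    by apply/subsetPn; exists w => //; rewrite inE wT orbT.
  by have := leq_trans lt (maxB _ PB'); rewrite ltnn.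
rewrite -setI_eq0 => /set0Pn[e]; rewrite !inE => /andP[eT eS].
exists e => //; apply: subset_trans TG; apply/subsetP => e'; rewrite !inE.
by move=> /andP[_]/subset_trans; apply; rewrite subUset sub1set wT.
Qed.

Lemma card_star (n : nat) (w : 'I_n) (e : edge n) :
  w \notin val e -> #|star w e| = 2%N.
Proof.
move=> we; have Te : #|w |: val e| = 3%N by rewrite cardsU1 we edge_card.
have <- : #|edges_in (w |: val e) :\ e| = 2%N.
  have := cardsD1 e (edges_in (w |: val e)).
  by rewrite card_edges_in Te inE subsetUr add1n => -[<-].
apply: eq_card => e'; rewrite !inE; apply/andP/andP => [[we' e'T]|[ne e'T]]; split=> //.
  by apply/eqP => ee; rewrite -ee we' in we.
apply: contraR ne => we'; rewrite -(inj_eq val_inj) eqEcard !edge_card leqnn andbT.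
apply/subsetP => x xe'; have := subsetP e'T _ xe'; rewrite !inE => /orP[/eqP xw|//].
by rewrite -xw xe' in we'.
Qed.

(** The leftover vertices of [g] are those [w] with [g w = Some e]; they close a
triangle over the edge [e]. *)
Definition attachment (n : nat) : finType := {ffun 'I_n -> option (edge n)}.

Definition leftover (n : nat) (g : attachment n) : {set 'I_n} :=
  [set w | g w != None].

Definition star_at (n : nat) (g : attachment n) (w : 'I_n) : graph n :=
  if g w is Some e then star w e else set0.

Definition stars (n : nat) (g : attachment n) : graph n :=
  \bigcup_w star_at g w.

Definition attached_to (n : nat) (B : {set gadget n}) (g : attachment n) : bool :=
  [forall w, if g w is Some e then (w \notin covered B) && (e \in used_edges B) else true].

Lemma attached_toP (n : nat) (B : {set gadget n}) (g : attachment n) w e :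
  attached_to B g -> g w = Some e -> w \notin covered B /\ e \in used_edges B.
Proof. by move=> /forallP/(_ w) + gw; rewrite gw => /andP. Qed.

Lemma card_used_edges (n : nat) (B : {set gadget n}) :
  gadget_system B -> #|used_edges B| = (3 * #|B|)%N.
Proof.
move=> /gadget_systemP[B1 _ B3]; rewrite card_bigcup_disjoint_in //.
rewrite mulnC -sum_nat_const; apply: eq_bigr => b /B1[b3 _ _ _].
by rewrite card_edges_in b3.
Qed.

Lemma card_gadget_system (n : nat) (B : {set gadget n}) :
  gadget_system B -> (#|B| <= n)%N.
Proof.
move=> /gadget_systemP[B1 B2 _].
rewrite -[leqRHS]card_ord; apply: leq_trans (max_card (covered B)).
rewrite /covered card_bigcup_disjoint_in // -sum1_card.
by apply: leq_sum => b /B1[_ _ + _]; rewrite card_gt0.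
Qed.

(** The stars of distinct leftover vertices are disjoint: each edge of a star
joins an uncovered vertex to a covered one. *)
Lemma card_stars (n : nat) (B : {set gadget n}) (g : attachment n) :
  gadget_system B -> attached_to B g -> #|stars g| = (2 * #|leftover g|)%N.
Proof.
move=> BS Bg; rewrite card_bigcup_disjoint.
  rewrite mulnC -sum_nat_const [RHS]big_mkcond /=; apply: eq_bigr => w _.
  rewrite inE /star_at; case gw: (g w) => [e|]; last by rewrite cards0.
  have [wC eS] := attached_toP Bg gw; rewrite card_star //.
  by apply: contra wC; apply/subsetP; exact: used_edge_covered.
move=> w w' ww'; rewrite -setI_eq0; apply/eqP/setP => e; rewrite !inE /star_at.
case gw: (g w) => [f|]; case gw': (g w') => [f'|]; rewrite ?inE ?andbF //.
apply/negP => /andP[/andP[we ew] /andP[w'e _]].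
have [_ fS] := attached_toP Bg gw; have [/negP w'C _] := attached_toP Bg gw'.
apply: w'C; apply: (subsetP (used_edge_covered BS fS)).
by have := subsetP ew _ w'e; rewrite !inE eq_sym (negPf ww').
Qed.

Lemma card_used_edges_stars (n : nat) (B : {set gadget n}) (g : attachment n) :
  gadget_system B -> attached_to B g ->
  #|used_edges B :|: stars g| = (3 * #|B| + 2 * #|leftover g|)%N.
Proof.
move=> BS Bg; rewrite -(card_stars BS Bg) -(card_used_edges BS).
apply/eqP; rewrite (leq_card_setU _ _) -setI_eq0; apply/eqP/setP => e; rewrite !inE.
apply/negP => /andP[eS /bigcupP[w _]]; rewrite /star_at.
case gw: (g w) => [f|]; rewrite !inE // => /andP[we _].
have [/negP wC _] := attached_toP Bg gw; apply: wC.
exact: (subsetP (used_edge_covered BS eS)).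
Qed.

(** Every graph contains the edges of some pair of a gadget system and an
attachment which cover all its triangle vertices: the objects over which the
union bound is taken. *)
Lemma exists_cover_encoding (n : nat) (G : graph n) :
  exists B g, [/\ gadget_system B, attached_to B g, used_edges B :|: stars g \subset G &
    (V_T G <= #|covered B| + #|leftover g|)%N].
Proof.
have [B [BS BG HB]] := exists_gadget_cover G.
pose g : attachment n := [ffun w => if in_triangle G w && (w \notin covered B) then
   [pick e in used_edges B | star w e \subset G] else None].
have gE w : in_triangle G w -> w \notin covered B -> exists e, g w = Some e.
  move=> wG wC; rewrite ffunE wG wC /=; case: pickP => [e _|ne]; first by exists e.
  by have [e eB eG] := HB _ wG wC; have := ne e; rewrite /= eB eG.
exists B, g; split=> //.
- apply/forallP => w; rewrite ffunE; case: ifP => // /andP[_ ->] /=.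
  by case: pickP => // e /andP[].
- rewrite subUset BG; apply/bigcupsP => w _; rewrite /star_at ffunE.
  case: ifP => _; last by rewrite sub0set.
  by case: pickP => [e /andP[]|]; rewrite ?sub0set.
- rewrite /V_T; apply: leq_trans (leq_card_setU _ _); apply: subset_leq_card.
  apply/subsetP => w; rewrite !inE => wG; case: (boolP (w \in covered B)) => //= wC.
  by have [e ->] := gE _ wG wC.
Qed.

(** Each vertex independently either is not attached, or chooses one of the used
edges. *)
Lemma sum_attachments_le (R : realType) (n : nat) (B : {set gadget n}) (x : R) :
  0 <= x ->
  \sum_(g | attached_to B g) x ^+ #|leftover g| <= (1 + #|used_edges B|%:R * x) ^+ n.
Proof.
move=> x0.
(* Enlarge the sum to all partial functions into the used edges: it factorizes. *)
pose h (o : option (edge n)) : R :=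
  if o is Some e then (if e \in used_edges B then x else 0) else 1.
have hge0 o : 0 <= h o by case: o => [e|] //=; case: ifP.
have -> : (1 + #|used_edges B|%:R * x) ^+ n = \prod_(w : 'I_n) \sum_o h o.
  rewrite prodr_const card_ord sum_option /= -big_mkcond /= sumr_const.
  by rewrite mulr_natl.
rewrite bigA_distr_bigA [leRHS](bigID (attached_to B)) /=.
rewrite -[leLHS]addr0; apply: lerD; last first.
  by apply: sumr_ge0 => g _; apply: prodr_ge0 => w _.
apply: ler_sum => g Bg; rewrite -prodr_const big_mkcond /=; apply: ler_prod => w _.
rewrite inE; case gw: (g w) => [e|] /=; last by rewrite ler01 lexx.
by have [_ ->] := attached_toP Bg gw; rewrite x0 lexx.
Qed.

(** The gadgets that cover at most two vertices; their weight is negligible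
compared with that of the full gadgets [(T, T)]. *)
Definition partial_gadgets (n : nat) : {set gadget n} :=
  [set b : gadget n | [&& #|b.1| == 3%N, b.2 \subset b.1 & b.1 != b.2]].

Lemma card_partial_gadgets (n : nat) : (#|partial_gadgets n| <= 8 * n ^ 3)%N.
Proof.
apply: (@leq_trans #|[set b : gadget n | (b.1 \in triples [set: 'I_n]) && (b.2 \subset b.1)]|).
  apply: subset_leq_card; apply/subsetP => b; rewrite !inE subsetT.
  by move=> /and3P[-> ->].
rewrite -sum1_card (eq_bigl (fun b : gadget n =>
   (b.1 \in triples [set: 'I_n]) && (b.2 \in powerset b.1))); last first.
  by move=> b; rewrite !inE.
rewrite -(pair_big_dep (fun T => T \in triples [set: 'I_n]) (fun T V => V \in powerset T)
   (fun _ _ => 1%N)) /=.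
rewrite (eq_bigr (fun=> 8%N)) => [|T]; last first.
  by rewrite inE => /andP[_ /eqP T3]; rewrite sum1_card card_powerset T3.
by rewrite sum_nat_const mulnC leq_mul2l /= card_triples_le.
Qed.

Definition full_part (n : nat) (B : {set gadget n}) : {set {set 'I_n}} :=
  [set T | (T, T) \in B].

Definition partial_part (n : nat) (B : {set gadget n}) : {set gadget n} :=
  [set b in B | b.1 != b.2].

Lemma full_part_packing (n : nat) (B : {set gadget n}) :
  gadget_system B -> full_part B \in packings [set: 'I_n] #|full_part B|.
Proof.
move=> /gadget_systemP[B1 B2 _]; rewrite inE eqxx andbT; apply/andP; split.
  apply/trivIsetP => T T'; rewrite !inE => TB T'B TT'.
  by apply: B2 TB T'B _; apply: contra TT' => /eqP[->].
by apply/subsetP => T; rewrite !inE subsetT => /B1[/= -> _ _ _].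
Qed.

Lemma partial_part_sub (n : nat) (B : {set gadget n}) :
  gadget_system B -> partial_part B \subset partial_gadgets n.
Proof.
move=> /gadget_systemP[B1 _ _]; apply/subsetP => b; rewrite !inE => /andP[bB ->].
by have [-> -> _ _] := B1 _ bB.
Qed.

(** A system is determined by its triangles covered in full, which form a packing,
and by its partial gadgets. *)
Lemma parts_inj (n : nat) :
  injective (fun B : {set gadget n} => (full_part B, partial_part B)).
Proof.
move=> B B' [] /setP E1 /setP E2; apply/setP => -[T V].
have [->|TV] := eqVneq T V; first by have := E1 V; rewrite !inE.
by have := E2 (T, V); rewrite !inE /= TV !andbT.
Qed.

Lemma prod_gadgets_split (R : realType) (n : nat) (B : {set gadget n}) (w : gadget n -> R) :
  \prod_(b in B) w b =
  \prod_(T in full_part B) w (T, T) * \prod_(b in partial_part B) w b.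
Proof.
rewrite (bigID (fun b : gadget n => b.1 == b.2)) /=; congr (_ * _); last first.
  by apply: eq_bigl => b; rewrite inE.
rewrite (reindex_onto (fun T => (T, T)) fst) /=; last first.
  by move=> [T V] /andP[_ /eqP /= ->].
by apply: eq_bigl => T; rewrite inE !eqxx !andbT.
Qed.

(** The full gadgets form a packing, while for the partial gadgets all
compatibility conditions can be dropped: any subset of [partial_gadgets] is
allowed, at the price of the exponential of their total weight. *)
Lemma sum_gadget_systems_le (R : realType) (n : nat) (p y : R) :
  0 <= p -> 1 <= y ->
  \sum_(B : {set gadget n} | gadget_system B) \prod_(b in B) (p ^+ 3 * y ^+ #|b.2|) <=
  expR (8 * n%:R ^+ 3 * (p ^+ 3 * y ^+ 2)) *
  \sum_(m < n.+1) #|packings [set: 'I_n] m|%:R * (p * y) ^+ (3 * m).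
Proof.
move=> p0 y1; have y0 : 0 <= y by apply: le_trans y1.
pose w (b : gadget n) := p ^+ 3 * y ^+ #|b.2|.
have w0 b : 0 <= w b by rewrite mulr_ge0 ?exprn_ge0.
pose packed (D : {set {set 'I_n}}) := D \in packings [set: 'I_n] #|D|.
pose F (z : {set {set 'I_n}} * {set gadget n}) :=
  (p * y) ^+ (3 * #|z.1|) * \prod_(b in z.2) w b.
have F0 z : 0 <= F z by rewrite mulr_ge0 ?exprn_ge0 ?mulr_ge0 ?prodr_ge0.
pose M := \sum_(z : {set {set 'I_n}} * {set gadget n} |
  packed z.1 && (z.2 \subset partial_gadgets n)) F z.
have le1 : \sum_(B : {set gadget n} | gadget_system B) \prod_(b in B) w b <= M.
  rewrite (eq_bigr (fun B => F (full_part B, partial_part B))); last first.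
    move=> B BS; rewrite prod_gadgets_split /F /=; congr (_ * _).
    rewrite exprM -prodr_const; apply: eq_bigr => T.
    rewrite inE => TB; have [B1 _ _] := gadget_systemP _ BS.
    by have [/= T3 _ _ _] := B1 _ TB; rewrite /w /= T3 exprMn.
  pose phi (B : {set gadget n}) := (full_part B, partial_part B).
  have -> : \sum_(B | gadget_system B) F (full_part B, partial_part B) =
      \sum_(z in phi @: [set B | gadget_system B]) F z.
    rewrite big_imset /= => [|B B' _ _]; last exact: parts_inj.
    by apply: eq_bigl => B; rewrite inE.
  rewrite big_mkcond /M [leRHS]big_mkcond /=; apply: ler_sum => z _.
  case: ifP => [/imsetP[B + ->]|_]; last by case: ifP.
  by rewrite inE => BS /=; rewrite /packed full_part_packing // partial_part_sub.
apply: le_trans le1 _; rewrite /M.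
rewrite -(pair_big packed (fun B : {set gadget n} => B \subset partial_gadgets n)
  (fun (D : {set {set 'I_n}}) (B : {set gadget n}) =>
     (p * y) ^+ (3 * #|D|) * \prod_(b in B) w b)) /=.
under eq_bigr do rewrite -big_distrr /= sum_subsets_prod.
rewrite -big_distrl /= mulrC; apply: ler_pM.
- by apply: prodr_ge0 => b _; rewrite addr_ge0.
- by apply: sumr_ge0 => D _; rewrite exprn_ge0 ?mulr_ge0.
- apply: le_trans (prod_1D_le_expR (c := p ^+ 3 * y ^+ 2) _) _.
    move=> b; rewrite inE w0 /= => /and3P[/eqP b3 b21 b12].
    rewrite ler_wpM2l ?exprn_ge0 // ler_weXn2l //.
    have : b.2 \proper b.1 by rewrite properEneq eq_sym b12.
    by move/proper_card; rewrite b3.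
  rewrite ler_expR ler_wpM2r ?mulr_ge0 ?exprn_ge0 //.
  by rewrite -natrX -natrM ler_nat card_partial_gadgets.
rewrite (partition_big (fun D : {set {set 'I_n}} => inord #|D| : 'I_n.+1) xpredT) //=.
apply: ler_sum => m _; rewrite (eq_bigl (fun D => D \in packings [set: 'I_n] m)) => [|D].
  rewrite (eq_bigr (fun=> (p * y) ^+ (3 * m))) => [|D]; last first.
    by rewrite inE => /and3P[_ _ /eqP ->].
  by rewrite sumr_const mulr_natl.
apply/andP/idP => [[DP /eqP Dm]|Dm].
  have Dn : (#|D| < n.+1)%N.
    rewrite ltnS leqNgt; apply/negP => nD; move: DP; rewrite /packed.
    have := @card_packings0 _ [set: 'I_n] #|D|; rewrite cardsT card_ord => /(_ _) E0.
    have /eqP : #|packings [set: 'I_n] (#|D|)| = 0%N by apply: E0; lia.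
    by rewrite cards_eq0 => /eqP ->; rewrite inE.
  by rewrite /= -Dm inordK.
have Em : #|D| = m by move: Dm; rewrite /= inE => /and3P[_ _ /eqP].
by rewrite /packed Em inord_val.
Qed.

(** The union bound over the coverings of [exists_cover_encoding].  The two terms
in the exponential account for the partial gadgets and for the leftover
vertices. *)
Lemma partition_fun_le (R : realType) (n : nat) (p y : R) :
  0 <= p <= 1 -> 1 <= y ->
  partition_fun n p y <=
  expR (8 * n%:R ^+ 3 * (p ^+ 3 * y ^+ 2) + 3 * n%:R ^+ 2 * (p ^+ 2 * y)) *
  \sum_(m < n.+1) #|packings [set: 'I_n] m|%:R * (p * y) ^+ (3 * m).
Proof.
move=> p01 y1; have /andP[p0 p1] := p01; have y0 : 0 <= y by apply: le_trans y1.
pose W (B : {set gadget n}) (g : attachment n) : R :=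
  y ^+ (#|covered B| + #|leftover g|).
have W0 B g : 0 <= W B g by rewrite exprn_ge0.
have step1 (G : graph n) : y ^+ V_T G * ER_law p G <=
    \sum_(B | gadget_system B) \sum_(g | attached_to B g)
      W B g * (if used_edges B :|: stars g \subset G then ER_law p G else 0).
  have E0 := ER_law_ge0 G p01.
  have [B [g [BS Bg BG VC]]] := exists_cover_encoding G.
  have Z0 (B' : {set gadget n}) g' :
      0 <= W B' g' * (if used_edges B' :|: stars g' \subset G then ER_law p G else 0).
    by rewrite mulr_ge0 //; case: ifP.
  rewrite (bigD1 B) //= (bigD1 g) //= BG -addrA -[leLHS]addr0.
  apply: lerD; first by rewrite ler_wpM2r // ler_weXn2l.
  by rewrite addr_ge0 ?sumr_ge0 // => B' _; rewrite sumr_ge0.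
apply: le_trans (ler_sum _ (fun G _ => step1 G)) _.
rewrite exchange_big /= expRD mulrAC.
apply: (@le_trans _ _ (\sum_(B : {set gadget n} | gadget_system B)
   (\prod_(b in B) (p ^+ 3 * y ^+ #|b.2|)) * expR (3 * n%:R ^+ 2 * (p ^+ 2 * y)))).
  apply: ler_sum => B BS; rewrite exchange_big /=.
  have wB : \prod_(b in B) (p ^+ 3 * y ^+ #|b.2|) = p ^+ (3 * #|B|) * y ^+ #|covered B|.
    have [_ B2 _] := gadget_systemP _ BS.
    rewrite big_split /= prodr_const -exprM; congr (_ * _).
    rewrite /covered card_bigcup_disjoint_in //.
    by rewrite (big_morph (fun k => y ^+ k) (exprD y) (expr0 y)).
  have -> : \sum_(g | attached_to B g) \sum_(G : graph n)
        W B g * (if used_edges B :|: stars g \subset G then ER_law p G else 0) =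
      \prod_(b in B) (p ^+ 3 * y ^+ #|b.2|) *
      \sum_(g | attached_to B g) (p ^+ 2 * y) ^+ #|leftover g|.
    rewrite wB big_distrr /=; apply: eq_bigr => g Bg.
    rewrite -big_distrr /= -big_mkcond /= sum_ER_law_superset card_used_edges_stars // /W.
    move: (#|B|) (#|leftover g|) (#|covered B|) => b l c.
    by rewrite (exprD y) (exprD p) exprMn -exprM; ring.
  apply: ler_wpM2l; first by rewrite wB mulr_ge0 ?exprn_ge0.
  have x0 : 0 <= p ^+ 2 * y by rewrite mulr_ge0 ?exprn_ge0.
  apply: le_trans (sum_attachments_le _ x0) _.
  (* A system has at most [n] gadgets, hence at most [3 n] used edges. *)
  have -> : 3 * n%:R ^+ 2 * (p ^+ 2 * y) = n%:R * (3 * n%:R * (p ^+ 2 * y)) by ring.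
  rewrite expRM_natl; apply: lerXn2r; rewrite ?nnegrE ?expR_ge0 ?addr_ge0 ?mulr_ge0 //.
  apply: le_trans (expR_ge1Dx _); rewrite lerD2l ler_wpM2r //.
  rewrite card_used_edges // natrM ler_wpM2l // ler_nat; exact: card_gadget_system.
rewrite -big_distrl /=; apply: ler_wpM2r; first exact: expR_ge0.
exact: sum_gadget_systems_le.
Qed.

(** * Planting a packing *)

Definition packing_edges (n : nat) (D : {set {set 'I_n}}) : graph n :=
  \bigcup_(T in D) edges_in T.

Lemma packing_edges_sub (n m : nat) (D : {set {set 'I_n}}) (G : graph n) :
  D \in packings [set: 'I_n] m ->
  (packing_edges D \subset G) = (D \subset triangles G).
Proof.
rewrite inE => /and3P[_ /subsetP D3 _]; apply/bigcupsP/subsetP => DG T TD.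
  by have := D3 _ TD; rewrite !inE => /andP[_ ->] /=; exact: DG.
by have := DG _ TD; rewrite inE => /andP[].
Qed.

Lemma card_packing_edges (n m : nat) (D : {set {set 'I_n}}) :
  D \in packings [set: 'I_n] m -> #|packing_edges D| = (3 * m)%N.
Proof.
rewrite inE => /and3P[/trivIsetP tD /subsetP D3 /eqP <-].
rewrite card_bigcup_disjoint_in => [|T T' TD T'D TT'].
  rewrite mulnC -sum_nat_const; apply: eq_bigr => T /D3.
  by rewrite card_edges_in inE => /andP[_ /eqP ->].
apply: edges_in_disjoint; have := tD _ _ TD T'D TT'.
by rewrite -setI_eq0 => /eqP ->; rewrite cards0.
Qed.

(** A triple outside the packing shares at most one edge with it: two edges of a
triple meet, so they would come from the same triple of the packing and
determine it. *)
Lemma card_packing_edgesU (n m : nat) (D : {set {set 'I_n}}) (T : {set 'I_n}) :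
  D \in packings [set: 'I_n] m -> #|T| = 3%N -> T \notin D ->
  (3 * m + 2 <= #|packing_edges D :|: edges_in T|)%N.
Proof.
move=> Dm T3 TD; rewrite cardsU (card_packing_edges Dm) card_edges_in T3.
suff : (#|packing_edges D :&: edges_in T| <= 1)%N by rewrite (_ : 'C(3, 2) = 3%N) //; lia.
apply/card_le1_eqP => e e'; rewrite !inE => /andP[/bigcupP[A AD + eT]] /andP[/bigcupP[B BD + e'T]].
rewrite !inE => eA e'B; apply/eqP; apply: contraNT TD; rewrite eq_sym => ee'.
have ltI : (#|val e :&: val e'| < 2)%N.
  rewrite -[ltnRHS](edge_card e); apply: proper_card; rewrite properE subsetIl /=.
  apply: contra ee' => /subsetIP[_ s]; apply/eqP/val_inj/eqP.
  by rewrite eqEcard; apply/andP; split; [exact: s | rewrite !edge_card].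
have cU := cardsUI (val e) (val e'); rewrite !edge_card in cU.
(* Here [j] and [i] are the sizes of the union and of the intersection. *)
have big_union i j : (j + i = 2 + 2 -> i < 2 -> 3 <= j)%N by lia.
have meet i j : (j + i = 2 + 2 -> j <= 3 -> 0 < i)%N by lia.
have UT : val e :|: val e' \subset T by rewrite subUset eT.
have ET : val e :|: val e' = T.
  by apply/eqP; rewrite eqEcard UT T3; exact: (big_union _ _ cU ltI).
have /card_gt0P[x] : (0 < #|val e :&: val e'|)%N.
  by apply: (meet _ _ cU); rewrite -T3; exact: subset_leq_card.
rewrite inE => /andP[xe xe']; move: Dm; rewrite inE => /and3P[/trivIsetP tD /subsetP D3 _].
have AB : A = B.
  apply/eqP; apply: contraT => AB; have := tD _ _ AD BD AB.
  rewrite -setI_eq0 => /eqP/setP/(_ x).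
  by rewrite !inE (subsetP eA _ xe) (subsetP e'B _ xe').
suff -> : T = A by [].
have := D3 _ AD; rewrite inE => /andP[_ /eqP A3].
by apply/eqP; rewrite eqEcard A3 T3 leqnn andbT -ET subUset eA AB.
Qed.

Lemma card_triples_over_edge (n : nat) (e : edge n) :
  (#|[set T in triples [set: 'I_n] | val e \subset T]| <= n)%N.
Proof.
rewrite -[leqRHS]card_ord -cardsT.
apply: leq_trans (leq_imset_card (fun x => x |: val e) [set: 'I_n]).
apply: subset_leq_card; apply/subsetP => T; rewrite !inE subsetT => /andP[/eqP T3 eT].
have /card_gt0P[x] : (0 < #|T :\: val e|)%N.
  by rewrite cardsD (setIidPr eT) T3 edge_card.
rewrite inE => /andP[xe xT]; apply/imsetP; exists x => //.
apply/esym/eqP; rewrite eqEcard subUset sub1set xT eT cardsU1 xe edge_card T3.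
by [].
Qed.

Lemma card_triples_over (n : nat) (S : graph n) :
  (#|[set T in triples [set: 'I_n] | ~~ [disjoint edges_in T & S]]| <= #|S| * n)%N.
Proof.
apply: (@leq_trans #|\bigcup_(e in S) [set T in triples [set: 'I_n] | val e \subset T]|).
  apply: subset_leq_card; apply/subsetP => T; rewrite !inE subsetT /= => /andP[T3].
  rewrite -setI_eq0 => /set0Pn[e]; rewrite !inE => /andP[eT eS].
  by apply/bigcupP; exists e => //; rewrite !inE subsetT T3.
apply: leq_trans (leq_card_bigcup _ _) _.
rewrite -sum_nat_const; apply: leq_sum => e _; exact: card_triples_over_edge.
Qed.

(** Given the packing, a further triangle either uses three new edges, for at most
[n^3] triples, or shares one of the [3 m] planted edges, for at most
[3 m n <= n^2] triples. *)
Lemma expected_extra_triangles_le (R : realType) (n m : nat) (p : R) (D : {set {set 'I_n}}) :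
  0 <= p <= 1 -> D \in packings [set: 'I_n] m -> (3 * m <= n)%N ->
  \sum_(G : graph n | packing_edges D \subset G) ER_law p G * #|triangles G :\: D|%:R <=
  p ^+ (3 * m) * (n%:R ^+ 3 * p ^+ 3 + n%:R ^+ 2 * p ^+ 2).
Proof.
move=> /andP[p0 p1] Dm mn.
set S := packing_edges D; set X := triples [set: 'I_n].
have -> : \sum_(G : graph n | S \subset G) ER_law p G * #|triangles G :\: D|%:R =
    \sum_(T in X :\: D) p ^+ #|S :|: edges_in T|.
  under eq_bigr => G _ do rewrite -sum1_card natr_sum big_distrr /=.
  rewrite (exchange_big_dep (mem (X :\: D))) /=; last first.
    by move=> G T _; rewrite !inE subsetT => /and3P[-> ->].
  apply: eq_bigr => T; rewrite !inE subsetT /= => /andP[TD T3].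
  rewrite -sum_ER_law_superset; under eq_bigr do rewrite mulr1.
  by apply: eq_bigl => G; rewrite subUset !inE T3 TD.
have cS : #|S| = (3 * m)%N := card_packing_edges Dm.
pose Y := [set T in X | ~~ [disjoint edges_in T & S]].
apply: (@le_trans _ _ (\sum_(T in X) p ^+ (3 * m) * p ^+ 3 +
   \sum_(T in Y) p ^+ (3 * m) * p ^+ 2)).
  have -> : \sum_(T in Y) p ^+ (3 * m) * p ^+ 2 =
      \sum_(T in X) if T \in Y then p ^+ (3 * m) * p ^+ 2 else 0.
    by rewrite -big_mkcondr; apply: eq_bigl => T; rewrite [T \in Y]inE andbA andbb.
  rewrite -big_split /= big_mkcond [leRHS]big_mkcond; apply: ler_sum => T _.
  rewrite !inE subsetT /=; case: (boolP (T \in D)) => [_|TD] /=.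
    by case: ifP => // _; rewrite addr_ge0 //; [|case: ifP => // _];
      rewrite mulr_ge0 ?exprn_ge0.
  case: eqP => [T3|] //=; case: ifPn => [_|/negPn dTS].
    rewrite -!exprD -[leLHS]add0r; apply: lerD; first exact: exprn_ge0.
    by apply: ler_wiXn2l => //; exact: card_packing_edgesU.
  rewrite addr0 -exprD; apply: ler_wiXn2l => //.
  move: dTS; rewrite disjoint_sym -(leq_card_setU S (edges_in T)) => /eqP ->.
  by rewrite cS card_edges_in T3.
rewrite !sumr_const mulrDr; apply: lerD.
  rewrite -[leLHS]mulr_natl mulrCA ler_wpM2l ?exprn_ge0 // ler_wpM2r ?exprn_ge0 //.
  by rewrite -natrX ler_nat card_triples_le.
rewrite -[leLHS]mulr_natl mulrCA ler_wpM2l ?exprn_ge0 // ler_wpM2r ?exprn_ge0 //.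
rewrite -natrX ler_nat; apply: leq_trans (card_triples_over S) _.
by rewrite cS leq_mul2r mn orbT.
Qed.

(** Markov's inequality for the number of further triangles. *)
Lemma planted_prob_ge (R : realType) (n m K : nat) (p : R) (D : {set {set 'I_n}}) :
  0 <= p <= 1 -> D \in packings [set: 'I_n] m -> (3 * m <= n)%N ->
  2 * (n%:R ^+ 3 * p ^+ 3 + n%:R ^+ 2 * p ^+ 2) <= K.+1%:R ->
  p ^+ (3 * m) <= 2 * \sum_(G : graph n | (packing_edges D \subset G) &&
                            (#|triangles G| <= m + K)%N) ER_law p G.
Proof.
move=> p01 Dm mn HK; have /andP[p0 p1] := p01.
have E := expected_extra_triangles_le p01 Dm mn.
rewrite -(card_packing_edges Dm) -sum_ER_law_superset in E *.
rewrite (bigID (fun G : graph n => (#|triangles G| <= m + K)%N)) /=.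
set good := \sum_(G | _ && (_ <= _)%N) _; set bad := \sum_(G | _) _.
suff : 2 * bad <= good + bad by lra.
have -> : good + bad = \sum_(G : graph n | packing_edges D \subset G) ER_law p G.
  by rewrite [RHS](bigID (fun G : graph n => (#|triangles G| <= m + K)%N)).
set tot := \sum_(G : graph n | packing_edges D \subset G) ER_law p G in E *.
have tot0 : 0 <= tot by apply: sumr_ge0 => G _; apply: ER_law_ge0.
have markov : K.+1%:R * bad <=
    \sum_(G : graph n | packing_edges D \subset G) ER_law p G * #|triangles G :\: D|%:R.
  rewrite big_distrr /= [leRHS](bigID (fun G : graph n => (#|triangles G| <= m + K)%N)) /=.
  rewrite -[leLHS]add0r; apply: lerD.
    by apply: sumr_ge0 => G _; rewrite mulr_ge0 // ER_law_ge0.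
  apply: ler_sum => G /andP[DG]; rewrite -ltnNge => KG.
  rewrite mulrC ler_wpM2l ?ER_law_ge0 // ler_nat cardsD.
  have cI : (#|triangles G :&: D| <= m)%N.
    have -> : m = #|D| by move: Dm; rewrite inE => /and3P[_ _ /eqP].
    by apply: subset_leq_card; exact: subsetIr.
  by rewrite ltn_subRL (leq_ltn_trans _ KG) // leq_add2r.
have := le_trans markov E => {}markov.
rewrite -(ler_pM2l (ltr0Sn R K)); nra.
Qed.

Lemma V_T_packing_ge (n m : nat) (D : {set {set 'I_n}}) (G : graph n) :
  D \in packings [set: 'I_n] m -> D \subset triangles G -> (3 * m <= V_T G)%N.
Proof.
move=> Dm /subsetP DG; rewrite -(card_packing_cover Dm); apply: subset_leq_card.
apply/subsetP => x /bigcupP[T TD xT]; rewrite inE.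
by apply/in_triangleP; exists T => //; exact: DG.
Qed.

(** A graph with at most [m + K] triangles contains at most ['C(m + K, m)]
packings of size [m], so summing [planted_prob_ge] over the packings counts
each such graph at most that many times. *)
Lemma partition_fun_ge (R : realType) (n m K : nat) (p y : R) :
  0 <= p <= 1 -> 1 <= y -> (3 * m <= n)%N ->
  2 * (n%:R ^+ 3 * p ^+ 3 + n%:R ^+ 2 * p ^+ 2) <= K.+1%:R ->
  #|packings [set: 'I_n] m|%:R * (p * y) ^+ (3 * m) <=
  2 * 'C(m + K, m)%:R * partition_fun n p y.
Proof.
move=> p01 y1 mn HK; have /andP[p0 p1] := p01.
have y0 : 0 <= y by apply: le_trans y1.
pose few (G : graph n) := (#|triangles G| <= m + K)%N.
have step (D : {set {set 'I_n}}) : D \in packings [set: 'I_n] m ->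
    p ^+ (3 * m) * y ^+ (3 * m) <= 2 * \sum_(G : graph n | (packing_edges D \subset G) && few G)
       y ^+ V_T G * ER_law p G.
  move=> Dm; have := planted_prob_ge p01 Dm mn HK.
  move=> /(ler_wpM2r (exprn_ge0 (3 * m) y0)) /le_trans; apply.
  rewrite -mulrA ler_pM2l // big_distrl /=; apply: ler_sum => G /andP[DG _].
  rewrite mulrC ler_wpM2r ?ER_law_ge0 // ler_weXn2l //.
  by apply: (V_T_packing_ge Dm); rewrite -(packing_edges_sub _ Dm).
have -> : #|packings [set: 'I_n] m|%:R * (p * y) ^+ (3 * m) =
    \sum_(D in packings [set: 'I_n] m) p ^+ (3 * m) * y ^+ (3 * m).
  by rewrite sumr_const mulr_natl exprMn.
apply: le_trans (ler_sum _ step) _.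
rewrite -big_distrr /= -mulrA ler_pM2l // (exchange_big_dep few) /=; last first.
  by move=> D G _ /andP[].
rewrite /partition_fun big_distrr /= [leRHS](bigID few) /= -[leLHS]addr0.
apply: lerD; last first.
  by apply: sumr_ge0 => G _; rewrite !mulr_ge0 ?exprn_ge0 ?ER_law_ge0.
apply: ler_sum => G fG; rewrite sumr_const -[leLHS]mulr_natl.
rewrite ler_wpM2r ?mulr_ge0 ?exprn_ge0 ?ER_law_ge0 // ler_nat.
apply: (@leq_trans 'C(#|triangles G|, m)); last exact: leq_bin2l.
rewrite -cards_draws; apply: subset_leq_card; apply/subsetP => D.
rewrite unfold_in => /andP[Dm /andP[DG _]]; rewrite inE -(packing_edges_sub _ Dm) DG.
by move: Dm; rewrite inE => /and3P[].
Qed.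

Local Open Scope classical_set_scope.

(** * The variational problem *)


(** The tangent line of [u ln u] at [v]; the difference of the two sides is the
relative entropy of two Poisson laws. *)
Lemma xlnx_tangent (R : realType) (u v : R) : 0 <= u -> 0 < v ->
  u - v <= u * (ln u - ln v).
Proof.
rewrite le_eqVlt => /orP[/eqP <-|u0] v0; first by rewrite mul0r sub0r oppr_le0 ltW.
have h : ln (v / u) <= v / u - 1.
  have := @le_ln1Dx R (v / u - 1); rewrite addrCA subrr addr0; apply.
  by rewrite ltrBrDl addrN divr_gt0.
rewrite ln_div ?posrE // in h.
have := ler_wpM2l (ltW u0) h.
have -> : u * (v / u - 1) = v - u by field; rewrite gt_eqF.
by rewrite -[ln u - ln v]opprB mulrN; lra.
Qed.

Lemma xlnx_tangent_lt (R : realType) (u v : R) : 0 <= u -> 0 < v -> u != v ->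
  u - v < u * (ln u - ln v).
Proof.
rewrite le_eqVlt => /orP[/eqP <-|u0] v0 uv; first by rewrite mul0r sub0r oppr_lt0.
have x0 : ln (v / u) != 0.
  rewrite ln_eq0 ?divr_gt0 //; apply: contra uv => /eqP vu.
  by rewrite -[X in _ == X](divfK (lt0r_neq0 u0) v) vu mul1r.
have := expR_gt1Dx x0; rewrite lnK ?posrE ?divr_gt0 // ln_div ?posrE // => h.
have := h; rewrite -(ltr_pM2l u0).
have -> : u * (v / u) = v by field; rewrite gt_eqF.
by rewrite -[ln u - ln v]opprB mulrN mulrDr mulr1; lra.
Qed.

(** The value of [theta + ln lambda] for which [a] is the maximizer: minus the
derivative at [a] of the entropy part [Lambda 0 1] of [Lambda]. *)
Definition slope (R : realType) (a : R) : R := ln (2 * a) / 3 - ln (1 - a).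

(** [Lambda] depends on [theta] and [lambda] only through [theta + ln lambda],
which is why tilting by edges and by triangle vertices act alike. *)
Lemma LambdaE (R : realType) (theta lambda a : R) :
  Lambda theta lambda a = Lambda 0 1 a + a * (theta + ln lambda).
Proof. by rewrite /Lambda ln1; ring. Qed.

(** The linear terms of the two relative entropies, [(1 - b) - (1 - a)] and
[(b - a) / 3], add up to [- (2 / 3) (b - a)]: the linear term of [Lambda] is
exactly the one that makes the difference a sum of relative entropies. *)
Lemma Lambda_gap (R : realType) (theta lambda a b : R) :
  0 < a < 1 -> 0 <= b <= 1 -> theta + ln lambda = slope a ->
  Lambda theta lambda a - Lambda theta lambda b =
  ((1 - b) * (ln (1 - b) - ln (1 - a)) - ((1 - b) - (1 - a))) +
  (b * (ln b - ln a) - (b - a)) / 3.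
Proof.
move=> /andP[a0 a1] /andP[b0 b1] s; rewrite !(LambdaE theta) s /slope /Lambda ln1.
have l6 : ln 6 = ln 2 + ln 3 :> R.
  by rewrite -lnM ?posrE //; congr ln; rewrite -natrM.
have b3 : b / 3 * ln (b / 3) = b / 3 * (ln b - ln 3).
  move: b0; rewrite le_eqVlt => /orP[/eqP <-|b0]; first by rewrite !mul0r.
  by rewrite ln_div ?posrE.
have a3 : ln (a / 3) = ln a - ln 3 by rewrite ln_div ?posrE.
have a2 : ln (2 * a) = ln 2 + ln a by rewrite lnM ?posrE.
by rewrite b3 a3 a2 l6; field.
Qed.

Lemma Lambda_max (R : realType) (theta lambda a b : R) :
  0 < a < 1 -> 0 <= b <= 1 -> theta + ln lambda = slope a ->
  Lambda theta lambda b <= Lambda theta lambda a.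
Proof.
move=> a01 b01 s; have /andP[a0 a1] := a01; have /andP[b0 b1] := b01.
rewrite -subr_ge0 (Lambda_gap a01 b01 s) addr_ge0 // ?mulr_ge0 ?subr_ge0 //;
  by apply: xlnx_tangent => //; lra.
Qed.

Lemma Lambda_max_uniq (R : realType) (theta lambda a b : R) :
  0 < a < 1 -> 0 <= b <= 1 -> theta + ln lambda = slope a -> b != a ->
  Lambda theta lambda b < Lambda theta lambda a.
Proof.
move=> a01 b01 s ba; have /andP[a0 a1] := a01; have /andP[b0 b1] := b01.
rewrite -subr_gt0 (Lambda_gap a01 b01 s) ltr_wpDl // ?mulr_gt0 ?subr_ge0 ?subr_gt0 //.
- by apply: xlnx_tangent; lra.
- exact: xlnx_tangent_lt.
Qed.

Lemma continuous_slope (R : realType) (a : R) : 0 < a < 1 ->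
  {for a, continuous (@slope R)}.
Proof.
move=> /andP[a0 a1]; apply: cvgB.
  apply: cvgMl; apply: (@continuous_comp _ _ _ (fun x : R => 2 * x) (@ln R)).
    by apply: cvgMr; exact: cvg_id.
  by apply: continuous_ln; rewrite mulr_gt0.
apply: (@continuous_comp _ _ _ (fun x : R => 1 - x) (@ln R)).
  by apply: cvgB; [exact: cvg_cst | exact: cvg_id].
by apply: continuous_ln; rewrite subr_gt0.
Qed.

Lemma continuous_Lambda (R : realType) (theta lambda a : R) : 0 < a < 1 ->
  {for a, continuous (Lambda theta lambda)}.
Proof.
move=> /andP[a0 a1].
have cln : {for a, continuous (fun x : R => ln (1 - x))}.
  apply: (@continuous_comp _ _ _ (fun x : R => 1 - x) (@ln R)).
    by apply: cvgB; [exact: cvg_cst | exact: cvg_id].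
  by apply: continuous_ln; rewrite subr_gt0.
have cl3 : {for a, continuous (fun x : R => ln (x / 3))}.
  apply: (@continuous_comp _ _ _ (fun x : R => x / 3) (@ln R)).
    by apply: cvgMl; exact: cvg_id.
  by apply: continuous_ln; rewrite divr_gt0.
have c3 : {for a, continuous (fun x : R => x / 3)} by apply: cvgMl; exact: cvg_id.
rewrite /Lambda; apply: cvgD; last by apply: cvgMl; exact: cvg_id.
apply: cvgB; last by apply: cvgMl.
apply: cvgB; last by apply: cvgMr; exact: cvg_id.
apply: cvgB; last exact: cvgM.
apply: cvgB; first by apply: cvgMr; exact: cvg_id.
by apply: cvgM => //; apply: cvgB; [exact: cvg_cst | exact: cvg_id].
Qed.

(** By the intermediate value theorem, [slope] tending to [-oo] at [0] and to
[+oo] at [1]. *)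
Lemma slope_surj (R : realType) (s : R) : exists2 a : R, 0 < a < 1 & slope a = s.
Proof.
have h0 : (0 : R) < 2^-1 by rewrite invr_gt0.
have h1 : 1 - 2^-1 = 2^-1 :> R by lra.
(* Below [1 / 2] the second term of [slope] is at most [ln 2], and above [1 / 2]
the first one is nonnegative; the bounds below use the other term. *)
pose a1 : R := Num.min 2^-1 (expR (3 * (s - ln 2)) / 2).
pose a2 : R := Num.max 2^-1 (1 - expR (- s)).
have a10 : 0 < a1 by rewrite lt_min h0 divr_gt0 ?expR_gt0.
have a1h : a1 <= 2^-1 by rewrite ge_min lexx.
have a2h : 2^-1 <= a2 by rewrite le_max lexx.
have a21 : a2 < 1 by rewrite gt_max ltrBlDr ltrDl expR_gt0 andbT; lra.
have s1 : slope a1 <= s.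
  have e1 : ln (2 * a1) <= 3 * (s - ln 2).
    rewrite -[leRHS]expRK ler_ln ?posrE ?expR_gt0 ?mulr_gt0 //.
    by rewrite -ler_pdivlMl // mulrC ge_min lexx orbT.
  have e2 : - ln 2 <= ln (1 - a1).
    rewrite -lnV ?posrE // ler_ln ?posrE //; lra.
  rewrite /slope; lra.
have s2 : s <= slope a2.
  have e1 : 0 <= ln (2 * a2) by apply: ln_ge0; lra.
  have e2 : ln (1 - a2) <= - s.
    rewrite -[leRHS]expRK ler_ln ?posrE ?expR_gt0 ?subr_gt0 //.
    by rewrite lerBlDl -lerBlDr le_max lexx orbT.
  rewrite /slope; lra.
have [||c] := @IVT R (@slope R) a1 a2 s (le_trans a1h a2h).
- apply: continuous_in_subspaceT => x; rewrite mem_setE in_itv /= => /andP[x1 x2].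
  by apply: continuous_slope; apply/andP; split; lra.
- by rewrite ge_min s1 le_max s2 orbT.
by rewrite in_itv /= => /andP[c1 c2] cs; exists c => //; apply/andP; split; lra.
Qed.

(** * Stirling bounds and the weight of packings *)

Definition stirling (R : realType) (k : nat) : R := k%:R * ln k%:R - k%:R.

Lemma ln_succ_sub (R : realType) (k : nat) : (0 < k)%N ->
  (k.+1%:R : R)^-1 <= ln (k.+1%:R : R) - ln (k%:R : R) <= (k%:R : R)^-1.
Proof.
move=> k0; have k0' : 0 < k%:R :> R by rewrite ltr0n.
have k1' : 0 < k.+1%:R :> R by rewrite ltr0n.
have u1 := xlnx_tangent (ltW k1') k0'; have u2 := xlnx_tangent (ltW k0') k1'.
have e : k.+1%:R = k%:R + 1 :> R by rewrite natr1.
apply/andP; split; first by rewrite -[_^-1]mul1r ler_pdivrMr //; lra.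
by rewrite -[_^-1]mul1r ler_pdivlMr //; lra.
Qed.

Lemma stirling_le_ln_fact (R : realType) (k : nat) : stirling R k <= ln (k`!%:R : R).
Proof.
elim: k => [|k IH]; first by rewrite /stirling mul0r subr0 fact0 ln1.
have [->|k0] := posnP k; first by rewrite /stirling factS fact0 muln1 mul1r ln1; lra.
rewrite factS natrM lnM ?posrE ?ltr0n ?fact_gt0 //.
have k0' : 0 < k%:R :> R by rewrite ltr0n.
have /andP[_ h] := ln_succ_sub R k0.
have := ler_wpM2l (ltW k0') h; rewrite divff ?gt_eqF // => {}h.
have e : k.+1%:R = k%:R + 1 :> R by rewrite natr1.
by move: IH; rewrite /stirling; nra.
Qed.

Lemma ln_fact_le_stirling (R : realType) (k : nat) :
  ln (k`!%:R : R) <= stirling R k + ln k%:R + 1.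
Proof.
elim: k => [|k IH]; first by rewrite /stirling mul0r fact0 ln1 ln0 //; lra.
have [->|k0] := posnP k; first by rewrite /stirling factS fact0 muln1 mul1r ln1; lra.
rewrite factS natrM lnM ?posrE ?ltr0n ?fact_gt0 //.
have k1' : 0 < k.+1%:R :> R by rewrite ltr0n.
have /andP[h _] := ln_succ_sub R k0.
have := ler_wpM2l (ltW k1') h; rewrite divff ?gt_eqF // => {}h.
have e : k.+1%:R = k%:R + 1 :> R by rewrite natr1.
by move: IH; rewrite /stirling; nra.
Qed.

Lemma xlnx_div (R : realType) (u v : R) : 0 <= u -> 0 < v ->
  u * ln (u / v) = u * (ln u - ln v).
Proof.
rewrite le_eqVlt => /orP[/eqP <-|u0] v0; first by rewrite !mul0r.
by rewrite ln_div ?posrE.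
Qed.

(** The terms in [ln n] cancel: this is where the exponent [1/3] of the critical
[beta] enters, through [ln (p y) = s - (2 / 3) ln n]. *)
Lemma stirling_Lambda (R : realType) (n m : nat) (s : R) : (0 < n)%N -> (3 * m <= n)%N ->
  stirling R n - stirling R m - stirling R (n - 3 * m) - m%:R * ln 6
    + (3 * m)%:R * (s - 2 / 3 * ln n%:R) =
  n%:R * (Lambda 0 1 ((3 * m)%:R / n%:R) + (3 * m)%:R / n%:R * s).
Proof.
move=> n0 mn; rewrite /stirling natrB // natrM /Lambda ln1.
have N0 : 0 < n%:R :> R by rewrite ltr0n.
have M0 : 0 <= m%:R :> R by rewrite ler0n.
have MN : 3 * m%:R <= n%:R :> R by rewrite -natrM ler_nat.
move: (n%:R : R) (m%:R : R) N0 M0 MN => N M N0 M0 MN.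
have -> : 1 - 3 * M / N = (N - 3 * M) / N by field; rewrite gt_eqF.
have -> : 3 * M / N / 3 = M / N by field; rewrite gt_eqF.
have e1 : (N - 3 * M) / N * ln ((N - 3 * M) / N) = (N - 3 * M) / N * (ln (N - 3 * M) - ln N).
  by rewrite mulrAC [in RHS]mulrAC xlnx_div // subr_ge0.
have e2 : M / N * ln (M / N) = M / N * (ln M - ln N).
  by rewrite mulrAC [in RHS]mulrAC xlnx_div.
by rewrite e1 e2; field; rewrite gt_eqF.
Qed.

Lemma ln_nat_le (R : realType) (k n : nat) : (0 < n)%N -> (k <= n)%N ->
  ln k%:R <= ln n%:R :> R.
Proof.
move=> n0; have [->|k0] := posnP k => kn; first by rewrite ln0 // ln_ge0 // ler1n.
by rewrite ler_ln ?posrE ?ltr0n // ler_nat.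
Qed.

(** In the application [x = p y] and [s = theta + ln (n p)]. *)
Lemma ln_packing_weight (R : realType) (n m : nat) (s x : R) :
  (0 < n)%N -> (3 * m <= n)%N -> 0 < x -> ln x = s - 2 / 3 * ln n%:R ->
  let w := #|packings [set: 'I_n] m|%:R * x ^+ (3 * m) in
  let L := Lambda 0 1 ((3 * m)%:R / n%:R) + (3 * m)%:R / n%:R * s in
  [/\ 0 < w, n%:R * L - 2 * (ln n%:R + 1) <= ln w
    & ln w <= n%:R * L + (ln n%:R + 1)].
Proof.
move=> n0 mn x0 lx w L.
have := @card_packings 'I_n [set: 'I_n] m; rewrite cardsT card_ord => /(_ mn) cardP.
have N0 : (0 < #|packings [set: 'I_n] m|)%N.
  by rewrite lt0n; apply/eqP => c0; move: cardP (fact_gt0 n); rewrite c0 !mul0n => <-.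
have w0 : 0 < w by rewrite mulr_gt0 ?ltr0n ?exprn_gt0.
have lw : ln w = ln (n`!%:R : R) - ln (m`!%:R : R) - ln ((n - 3 * m)`!%:R : R) - m%:R * ln 6
    + (3 * m)%:R * ln x.
  rewrite -cardP !natrM !lnM ?posrE ?mulr_gt0 ?exprn_gt0 ?ltr0n ?fact_gt0 ?expn_gt0 //.
  by rewrite lnXn // natrX lnXn // -[ln x *+ _]mulr_natl -[ln 6 *+ _]mulr_natl; ring.
have := stirling_Lambda s n0 mn; rewrite -/L -lx => eL.
have n1 := stirling_le_ln_fact R n; have n2 := ln_fact_le_stirling R n.
have m1 := stirling_le_ln_fact R m; have m2 := ln_fact_le_stirling R m.
have k1 := stirling_le_ln_fact R (n - 3 * m); have k2 := ln_fact_le_stirling R (n - 3 * m).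
have lm : ln m%:R <= ln n%:R :> R by apply: ln_nat_le => //; lia.
have lk : ln (n - 3 * m)%:R <= ln n%:R :> R by apply: ln_nat_le => //; exact: leq_subr.
by split=> //; rewrite lw -eL; lra.
Qed.

Lemma ln_sum_le (R : realType) (n : nat) (f : 'I_n.+1 -> R) (c : R) :
  (forall i, f i <= expR c) -> 0 < \sum_i f i ->
  ln (\sum_i f i) <= ln n.+1%:R + c.
Proof.
move=> fc f0; rewrite -[c]expRK -lnM ?posrE ?expR_gt0 ?ltr0n //.
rewrite ler_ln ?posrE ?mulr_gt0 ?expR_gt0 ?ltr0n //.
apply: le_trans (ler_sum _ (fun i _ => fc i)) _.
by rewrite sumr_const card_ord mulr_natl.
Qed.

(** * The free energy *)

(** [s] stands for [theta + ln (n p)], whose limit is [theta + ln lambda]; the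
absolute value is the price of replacing one by the other. *)
Lemma ln_partition_fun_le (R : realType) (n : nat) (p y s theta lambda a : R) :
  (0 < n)%N -> 0 < p <= 1 -> 1 <= y -> ln (p * y) = s - 2 / 3 * ln n%:R ->
  0 < a < 1 -> theta + ln lambda = slope a ->
  ln (partition_fun n p y) <=
  8 * n%:R ^+ 3 * (p ^+ 3 * y ^+ 2) + 3 * n%:R ^+ 2 * (p ^+ 2 * y) +
  (n%:R * (Lambda theta lambda a + `|s - (theta + ln lambda)|)
     + (ln n%:R + 1) + ln n.+1%:R).
Proof.
move=> n0 /andP[p0 p1] y1 lpy a01 sa.
have y0 : 0 < y by apply: lt_le_trans y1.
have x0 : 0 < p * y by rewrite mulr_gt0.
have N0 : 0 < n%:R :> R by rewrite ltr0n.
pose f (m : 'I_n.+1) := #|packings [set: 'I_n] m|%:R * (p * y) ^+ (3 * m).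
have f0 : 0 < \sum_m f m.
  rewrite (bigD1 ord0) //= ltr_pwDl //.
    by have [] := ln_packing_weight n0 (leq0n n : (3 * 0 <= n)%N) x0 lpy.
  by apply: sumr_ge0 => m _; rewrite mulr_ge0 // exprn_ge0 // ltW.
have Z0 : 0 < partition_fun n p y.
  exact: lt_le_trans ltr01 (partition_fun_ge1 n (ltW p0) p1 y1).
have := @partition_fun_le R n p y; rewrite (ltW p0) p1 => /(_ isT y1).
rewrite -ler_ln ?posrE // ?mulr_gt0 ?expR_gt0 // lnM ?posrE ?expR_gt0 // expRK.
move=> /le_trans; apply; rewrite lerD2l.
rewrite addrC; apply: ln_sum_le => // m; rewrite /f.
have [mn|mn] := leqP (3 * m) n; last first.
  by rewrite card_packings0 ?mul0r ?expR_ge0 // cardsT card_ord.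
have [w0 _ w2] := ln_packing_weight n0 mn x0 lpy.
rewrite -[leLHS]lnK ?posrE // ler_expR; apply: le_trans w2 _.
rewrite lerD2r ler_pM2l //.
set b := (3 * m)%:R / n%:R.
have b01 : 0 <= b <= 1.
  by rewrite divr_ge0 // ler_pdivrMr // mul1r ler_nat.
have := Lambda_max a01 b01 sa; rewrite (LambdaE _ _ b).
have := ler_norm (s - (theta + ln lambda)); have := normr_ge0 (s - (theta + ln lambda)).
have /andP[b0 b1] := b01; nra.
Qed.

(** The loss ['C(m + K, m) <= (m + K) ^ K] is polynomial in [n] for
fixed [K]. *)
Lemma ln_partition_fun_ge (R : realType) (n m K : nat) (p y s theta lambda : R) :
  (0 < n)%N -> (3 * m <= n)%N -> 0 < p <= 1 -> 1 <= y ->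
  ln (p * y) = s - 2 / 3 * ln n%:R ->
  2 * (n%:R ^+ 3 * p ^+ 3 + n%:R ^+ 2 * p ^+ 2) <= K.+1%:R ->
  n%:R * (Lambda theta lambda ((3 * m)%:R / n%:R) - `|s - (theta + ln lambda)|)
   - 2 * (ln n%:R + 1) - ln 2 - K%:R * (ln n%:R + ln K.+1%:R)
  <= ln (partition_fun n p y).
Proof.
move=> n0 mn /andP[p0 p1] y1 lpy HK.
have y0 : 0 < y by apply: lt_le_trans y1.
have x0 : 0 < p * y by rewrite mulr_gt0.
have N0 : 0 < n%:R :> R by rewrite ltr0n.
have [w0 w1 _] := ln_packing_weight n0 mn x0 lpy.
have := @partition_fun_ge R n m K p y; rewrite (ltW p0) p1 => /(_ isT y1 mn HK) Zge.
have C0 : 0 < 'C(m + K, m)%:R :> R by rewrite ltr0n bin_gt0 leq_addr.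
have Z0 : 0 < partition_fun n p y.
  exact: lt_le_trans ltr01 (partition_fun_ge1 n (ltW p0) p1 y1).
have {}Zge : ln (#|packings [set: 'I_n] m|%:R * (p * y) ^+ (3 * m)) <=
    ln 2 + ln 'C(m + K, m)%:R + ln (partition_fun n p y).
  by rewrite -!lnM ?posrE ?mulr_gt0 // ler_ln ?posrE // ?mulr_gt0.
have lC : ln ('C(m + K, m)%:R : R) <= K%:R * (ln n%:R + ln K.+1%:R).
  rewrite -lnM ?posrE ?ltr0n // mulr_natl -lnXn ?mulr_gt0 ?ltr0n //.
  rewrite ler_ln ?posrE ?C0 ?exprn_gt0 ?mulr_gt0 ?ltr0n // -natrM -natrX ler_nat.
  rewrite -bin_sub ?leq_addr // addKn.
  apply: leq_trans (bin_le_expn _ _) _; apply: leq_expn2r.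
  by rewrite mulnS leq_add // ?leq_pmull //; apply: leq_trans mn; rewrite leq_pmull.
set b := (3 * m)%:R / n%:R in w1 *.
have b01 : 0 <= b <= 1.
  by rewrite divr_ge0 // ler_pdivrMr // mul1r ler_nat.
have := ler_norm (- (s - (theta + ln lambda))); rewrite normrN.
rewrite (LambdaE _ _ b).
have := normr_ge0 (s - (theta + ln lambda)).
set A := `|_|; set d := s - _ => A0 dA.
have /andP[b0 b1] := b01.
have h1 : b * - d <= b * A by rewrite ler_wpM2l.
have h2 : b * A <= A by rewrite ler_piMl.
have Eb : Lambda 0 1 b + b * (theta + ln lambda) - A <= Lambda 0 1 b + b * s.
  by rewrite /d in h1; lra.
have := ler_wpM2l (ltW N0) Eb; move: w1 Zge lC; lra.
Qed.

(** [n ^ (-1/3)] for positive [n]. *)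
Definition inv_cbrt (R : realType) (n : nat) : R := expR (- (ln n%:R / 3)).

Lemma cvg_inv_cbrt (R : realType) : inv_cbrt R @ \oo --> (0 : R).
Proof.
apply/cvgrPdist_lt => e e0; near=> n.
have n0 : (0 < n%:R :> R) by rewrite ltr0n; near: n; exact: nbhs_infty_gt.
rewrite sub0r normrN gtr0_norm ?expR_gt0 // /inv_cbrt.
rewrite -[ltRHS]lnK ?posrE // ltr_expR.
have : - ln e * 3 < ln n%:R.
  rewrite -[ltLHS]expRK ltr_ln ?posrE ?expR_gt0 //.
  by near: n; exact: nbhs_infty_gtr.
lra.
Unshelve. all: by end_near. Qed.

Lemma cvg_invn (R : realType) : (fun n : nat => n%:R^-1 : R) @ \oo --> (0 : R).
Proof.
apply/cvgrPdist_lt => e e0; near=> n.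
have n0 : (0 < n%:R :> R) by rewrite ltr0n; near: n; exact: nbhs_infty_gt.
rewrite sub0r normrN gtr0_norm ?invr_gt0 // -[e]invrK ltf_pV2 ?posrE ?invr_gt0 //.
by near: n; exact: nbhs_infty_gtr.
Unshelve. all: by end_near. Qed.

(** From [ln n / 3 <= exp (ln n / 3)]. *)
Lemma cvg_ln_div_nat (R : realType) : (fun n : nat => n%:R^-1 * ln n%:R : R) @ \oo --> (0 : R).
Proof.
have h : (fun n => 3 * inv_cbrt R n) @ \oo --> (0 : R).
  by rewrite -[X in _ --> X](mulr0 3); apply: cvgMr; exact: cvg_inv_cbrt.
apply: (squeeze_cvgr _ (cvg_cst 0) h); near=> n.
have n1 : (1 <= n%:R :> R) by rewrite ler1n; near: n; exact: nbhs_infty_gt.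
have n0 : (0 < n%:R :> R) by apply: lt_le_trans n1.
have l0 : 0 <= ln n%:R :> R by apply: ln_ge0.
apply/andP; split; first by rewrite mulr_ge0 // invr_ge0 ltW.
have e1 := expR_ge1Dx (ln n%:R / 3 : R).
have -> : n%:R^-1 = inv_cbrt R n * inv_cbrt R n * inv_cbrt R n :> R.
  rewrite /inv_cbrt -!expRD -[in LHS](@lnK R n%:R) ?posrE // -expRN; congr expR; lra.
have c0 : 0 < inv_cbrt R n by apply: expR_gt0.
have c1 : inv_cbrt R n <= 1 by rewrite expR_le1 oppr_le0 divr_ge0.
have c2 : inv_cbrt R n * (ln n%:R / 3) <= 1.
  by rewrite /inv_cbrt expRN mulrC ler_pdivrMr ?expR_gt0 // mul1r; lra.
have c3 : inv_cbrt R n * inv_cbrt R n <= inv_cbrt R n by rewrite ler_piMr // ltW.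
have := ler_wpM2l (mulr_ge0 (ltW c0) (ltW c0)) c2; nra.
Unshelve. all: by end_near. Qed.

Lemma beta_lnE (R : realType) (theta : R) (n : nat) : (1 < n)%N ->
  beta_ theta n * ln n%:R = ln n%:R / 3 + theta.
Proof.
move=> n1; have l0 : 0 < ln n%:R :> R by rewrite ln_gt0 // ltr1n.
by rewrite /beta_; field; rewrite gt_eqF.
Qed.

Lemma near_tilt_ge1 (R : realType) (theta : R) :
  \forall n \near \oo, 1 <= expR (beta_ theta n * ln n%:R).
Proof.
near=> n.
have n1 : (1 < n)%N by near: n; exact: nbhs_infty_gt.
rewrite -[leLHS]expR0 ler_expR beta_lnE //.
have : - (3 * theta) <= ln n%:R.
  rewrite -[leLHS]expRK ler_ln ?posrE ?expR_gt0 ?ltr0n ?(ltn_trans _ n1) //.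
  by near: n; exact: nbhs_infty_ger.
lra.
Unshelve. all: by end_near. Qed.

(** Allowing [n p_n -> lambda] rather than [p_n = lambda / n] is needed for the
edge count, whose tilt changes [p] into a sequence of this kind. *)
Lemma free_energy_cvg (R : realType) (theta lambda a : R) (p : nat -> R) :
  0 < lambda -> 0 < a < 1 -> theta + ln lambda = slope a ->
  (fun n => n%:R * p n) @ \oo --> lambda ->
  (fun n : nat => n%:R^-1 *
     ln (partition_fun n (p n) (expR (beta_ theta n * ln n%:R)))) @ \oo -->
  Lambda theta lambda a.
Proof.
move=> lam0 a01 sa pc; have /andP[a0 a1] := a01.
pose q n := n%:R * p n.
pose d n := `|theta + ln (q n) - (theta + ln lambda)|.
pose y2 n := expR (2 * theta) * inv_cbrt R n.
(* [K + 1] eventually exceeds twice the expected number of further triangles,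
[b n] is the proportion of vertices covered by [m n] triples, and [y2 n] is
[y ^ 2 / n] for [n > 1]; [U] and [W] are the upper and lower bounds. *)
pose K := Num.truncn (2 * ((lambda + 1) ^+ 3 + (lambda + 1) ^+ 2)).
pose m n := Num.truncn (a * n%:R / 3).
pose b n : R := (3 * m n)%:R / n%:R.
pose U n := (8 * (q n * q n * q n) + 3 * (q n * q n)) * y2 n + (Lambda theta lambda a + d n)
  + (2 * (n%:R^-1 * ln n%:R) + (1 + ln 2) * n%:R^-1).
pose W n := Lambda theta lambda (b n) - d n
  - ((2 + K%:R) * (n%:R^-1 * ln n%:R) + (2 + ln 2 + K%:R * ln K.+1%:R) * n%:R^-1).
have dc : d @ \oo --> (0 : R).
  have -> : 0 = `|theta + ln lambda - (theta + ln lambda)| :> R by rewrite subrr normr0.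
  apply: cvg_norm; apply: cvgB; last exact: cvg_cst.
  apply: cvgD; first exact: cvg_cst.
  apply: (cvg_comp _ _ pc); exact: continuous_ln.
have bc : b @ \oo --> a.
  have l1 : (fun n : nat => a - 3 * n%:R^-1) @ \oo --> a.
    rewrite -[X in _ --> X]subr0 -(mulr0 3).
    by apply: cvgB; [exact: cvg_cst | apply: cvgMr; exact: cvg_invn].
  apply: (squeeze_cvgr _ l1 (cvg_cst a)); near=> n.
  have n0 : (0 < n%:R :> R) by rewrite ltr0n; near: n; exact: nbhs_infty_gt.
  have /truncn_itv/andP[t1 t2] : 0 <= a * n%:R / 3 by rewrite !mulr_ge0 // ltW.
  rewrite /b natrM /=; apply/andP; split.
    rewrite ler_pdivlMr //.
    have -> : (a - 3 * n%:R^-1) * n%:R = a * n%:R - 3 by field; rewrite gt_eqF.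
    by move: t2; rewrite -/(m n) -[(m n).+1%:R]natr1; lra.
  by rewrite ler_pdivrMr //; move: t1; rewrite -/(m n); lra.
have Uc : U @ \oo --> Lambda theta lambda a.
  have -> : Lambda theta lambda a = (8 * (lambda * lambda * lambda) + 3 * (lambda * lambda)) *
      (expR (2 * theta) * 0) + (Lambda theta lambda a + 0) + (2 * 0 + (1 + ln 2) * 0) by ring.
  apply: cvgD; last first.
    by apply: cvgD; apply: cvgMr; [exact: cvg_ln_div_nat | exact: cvg_invn].
  apply: cvgD; last by apply: cvgD => //; exact: cvg_cst.
  apply: cvgM; last by apply: cvgMr; exact: cvg_inv_cbrt.
  by apply: cvgD; apply: cvgMr; do ?apply: cvgM.
have Wc : W @ \oo --> Lambda theta lambda a.
  have -> : Lambda theta lambda a = Lambda theta lambda a - 0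
    - ((2 + K%:R) * 0 + (2 + ln 2 + K%:R * ln K.+1%:R) * 0) by ring.
  apply: cvgB; last first.
    by apply: cvgD; apply: cvgMr; [exact: cvg_ln_div_nat | exact: cvg_invn].
  by apply: cvgB => //; apply: (cvg_comp _ _ bc); exact: continuous_Lambda.
apply: (squeeze_cvgr _ Wc Uc); near=> n.
have n2 : (1 < n)%N by near: n; exact: nbhs_infty_gt.
have n0 : (0 < n)%N by apply: ltn_trans n2.
have N0 : (0 < n%:R :> R) by rewrite ltr0n.
have q0 : 0 < q n by near: n; apply: (cvgr_gt lambda).
have q1 : q n < lambda + 1 by near: n; apply: (cvgr_lt lambda) => //; rewrite ltrDl.
have nl : lambda + 1 <= n%:R by near: n; exact: nbhs_infty_ger.
have l0 : 0 < ln n%:R :> R by rewrite ln_gt0 // ltr1n.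
have bE := beta_lnE theta n2.
have y1 : 1 <= expR (beta_ theta n * ln n%:R) by near: n; exact: near_tilt_ge1.
rewrite bE in y1 *; set y := expR _ in y1 *.
have pE : p n = q n / n%:R by rewrite /q; field; rewrite gt_eqF.
have p0 : 0 < p n by rewrite pE divr_gt0.
have p1 : p n <= 1 by rewrite pE ler_pdivrMr // mul1r; apply: le_trans nl; apply: ltW.
have p01 : 0 < p n <= 1 by rewrite p0.
have lpy : ln (p n * y) = (theta + ln (q n)) - 2 / 3 * ln n%:R.
  rewrite lnM ?posrE ?expR_gt0 // expRK pE ln_div ?posrE //; lra.
have y2E : y ^+ 2 = n%:R * y2 n.
  rewrite /y2 /inv_cbrt -[X in _ = X * _](@lnK R n%:R) ?posrE // -!expRD -expRM_natl.
  by congr expR; lra.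
have Yy : y <= y ^+ 2 by rewrite expr2 ler_peMr // (le_trans ler01 y1).
apply/andP; split.
  have mn : (3 * m n <= n)%N.
    have /truncn_itv/andP[t1 _] : 0 <= a * n%:R / 3 by rewrite !mulr_ge0 // ltW.
    rewrite -(ler_nat R) natrM; move: t1; rewrite -/(m n).
    have : a * n%:R <= n%:R by rewrite ler_piMl // ltW.
    lra.
  have HK : 2 * (n%:R ^+ 3 * p n ^+ 3 + n%:R ^+ 2 * p n ^+ 2) <= K.+1%:R.
    rewrite -!exprMn -/(q n); apply: le_trans (ltW (truncnS_gt _)).
    by rewrite ler_pM2l //; apply: lerD; apply: lerXn2r; rewrite ?nnegrE ?addr_ge0 ?ltW.
  have := ln_partition_fun_ge theta lambda n0 mn p01 y1 lpy HK.
  rewrite -/(b n) -/(d n) => /(ler_wpM2l (_ : 0 <= n%:R^-1 :> R)) => h.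
  apply: le_trans (h _); last by rewrite invr_ge0 ltW.
  rewrite le_eqVlt; apply/orP; left; apply/eqP.
  by rewrite /W; field; rewrite gt_eqF.
have := ln_partition_fun_le n0 p01 y1 lpy a01 sa.
rewrite -/(d n) => /(ler_wpM2l (_ : 0 <= n%:R^-1 :> R)) h.
apply: le_trans (h _) _; first by rewrite invr_ge0 ltW.
have ln1n : ln (n.+1%:R : R) <= ln n%:R + ln 2.
  have h1 : n.+1%:R <= n%:R * 2 :> R.
    have : 1 <= n%:R :> R by rewrite ler1n.
    by rewrite -[n.+1%:R]natr1; lra.
  rewrite -lnM ?posrE // ler_ln ?posrE ?ltr0Sn //.
  by rewrite mulr_gt0.
have expand (A B X Y Z : R) : n%:R^-1 * (A + B + (n%:R * X + Y + Z)) =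
    n%:R^-1 * A + n%:R^-1 * B + (X + n%:R^-1 * Y + n%:R^-1 * Z).
  by field; rewrite gt_eqF.
rewrite expand.
have e1 : n%:R^-1 * (8 * n%:R ^+ 3 * (p n ^+ 3 * y ^+ 2)) = 8 * (q n * q n * q n) * y2 n.
  by rewrite y2E /q; field; rewrite gt_eqF.
have e2 : n%:R^-1 * (3 * n%:R ^+ 2 * (p n ^+ 2 * y)) <= 3 * (q n * q n) * y2 n.
  have -> : 3 * (q n * q n) * y2 n = n%:R^-1 * (3 * n%:R ^+ 2 * (p n ^+ 2 * y ^+ 2)).
    by rewrite y2E /q; field; rewrite gt_eqF.
  rewrite ler_pM2l ?invr_gt0 // ler_pM2l ?mulr_gt0 ?exprn_gt0 //.
  by rewrite ler_pM2l ?exprn_gt0.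
have e3 : n%:R^-1 * ln n.+1%:R <= n%:R^-1 * ln n%:R + n%:R^-1 * ln 2 :> R.
  have ni0 : 0 <= n%:R^-1 :> R by rewrite invr_ge0 ltW.
  by have := ler_wpM2l ni0 ln1n; rewrite [n%:R^-1 * (_ + _)]mulrDr.
rewrite e1 /U; lra.
Unshelve. all: by end_near. Qed.

(** * Concentration from exponential moments *)

Lemma slope_lt (R : realType) (a b : R) : 0 < a -> a < b -> b < 1 -> slope a < slope b.
Proof.
move=> a0 ab b1.
have h1 : ln (2 * a) < ln (2 * b) by rewrite ltr_ln ?posrE; lra.
have h2 : ln (1 - b) < ln (1 - a) by rewrite ltr_ln ?posrE; lra.
by rewrite /slope; lra.
Qed.

Lemma cvg_expR_natmul (R : realType) (u : nat -> R) (l : R) :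
  l < 0 -> u @ \oo --> l -> (fun n => expR (n%:R * u n)) @ \oo --> (0 : R).
Proof.
move=> l0 ul; apply/cvgrPdist_lt => e e0; near=> n.
have n0 : (0 < n%:R :> R) by rewrite ltr0n; near: n; exact: nbhs_infty_gt.
rewrite sub0r normrN gtr0_norm ?expR_gt0 // -[ltRHS]lnK ?posrE // ltr_expR.
have u2 : u n < l / 2 by near: n; apply: (cvgr_lt l) => //; lra.
have n2 : ln e / (l / 2) < n%:R by near: n; exact: nbhs_infty_gtr.
have l2 : l / 2 < 0 by lra.
rewrite ltr_ndivrMr // in n2.
by apply: lt_trans n2; rewrite ltr_pM2l.
Unshelve. all: by end_near. Qed.

Definition mgf (R : realType) (n : nat) (mu X : graph n -> R) (t : R) : R :=
  \sum_(G : graph n) mu G * expR (t * X G).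

(** On the event, one of the two exponentials is at least [1]. *)
Lemma chernoff (R : realType) (n : nat) (mu X : graph n -> R) (c e t1 t2 : R) :
  (0 < n)%N -> (forall G, 0 <= mu G) -> 0 <= t1 -> t2 <= 0 ->
  prob mu [pred G | e < `|X G / n%:R - c|] <=
  expR (n%:R * - (t1 * (c + e))) * mgf mu X t1 +
  expR (n%:R * - (t2 * (c - e))) * mgf mu X t2.
Proof.
move=> n0 mu0 t10 t20; have N0 : 0 < n%:R :> R by rewrite ltr0n.
rewrite /mgf !big_distrr -big_split /prob /= big_mkcond /=; apply: ler_sum => G _.
rewrite mulrCA [X in _ <= _ + X]mulrCA -!expRD -mulrDr.
case: ifP => [h|_]; last by rewrite mulr_ge0 // addr_ge0 // expR_ge0.
rewrite -[leLHS]mulr1 ler_wpM2l //.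
have xE : X G = n%:R * (X G / n%:R) by field; rewrite gt_eqF.
move: h; rewrite lter_normr => /orP[h|h].
  rewrite -[leLHS]addr0; apply: lerD; last exact: expR_ge0.
  rewrite -[leLHS]expR0 ler_expR.
  have : c + e <= X G / n%:R by lra.
  rewrite ler_pdivlMr // => /(ler_wpM2l t10). lra.
rewrite -[leLHS]add0r; apply: lerD; first exact: expR_ge0.
rewrite -[leLHS]expR0 ler_expR.
have : X G / n%:R <= c - e by lra.
rewrite ler_pdivrMr // => /(ler_wnM2l t20); lra.
Qed.

(** The parameter of the exponential moments is written [t = slope b - slope a],
where [b] is the maximizer of the tilted problem.  At first order in [t] the
bound on the limit is [t (k + a)], since [b] is close to [a]; taking [b] on
either side of [a] makes both exponents of the Chernoff bound negative.  For the
triangle vertices [k = 0], for the edges [k = lambda / 2]. *)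
Lemma cvg_in_prob_of_mgf (R : realType) (mu X : forall n, graph n -> R) (a k : R) :
  0 < a < 1 -> 0 <= k ->
  (\forall n \near \oo, forall G, 0 <= mu n G) ->
  (forall t, \forall n \near \oo, 0 < mgf (mu n) (X n) t) ->
  (forall b : R, 0 < b < 1 -> exists2 l : R,
     (fun n : nat => n%:R^-1 * ln (mgf (mu n) (X n) (slope b - slope a))) @ \oo --> l &
     l <= k * (expR (slope b - slope a) - 1) + (slope b - slope a) * b) ->
  cvg_in_prob mu (fun n G => X n G / n%:R) (k + a).
Proof.
move=> a01 k0 mu0 M0 Hb e e0; have /andP[a0 a1] := a01.
pose h b := k * expR (slope b - slope a) + b.
have hc : h @ a --> h a.
  apply: cvgD; last exact: cvg_id.
  apply: cvgMr; apply: (cvg_comp (fun b => slope b - slope a) (@expR R));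
    last exact: continuous_expR.
  by apply: cvgB; [exact: continuous_slope | exact: cvg_cst].
have ha : h a = k + a by rewrite /h subrr expR0 mulr1.
have /cvgrPdist_lt/(_ e e0)/nbhs_ballP[r /= r0 hr] := hc.
have hbnd b : `|a - b| < r -> `|k + a - h b| < e.
  by move=> ab; rewrite -ha; apply: hr.
(* With this convexity bound, the exponent at [b] is at most [t] times
[h b - (k + a + e)] for [t > 0], and similarly for [t < 0], so continuity of [h]
at [a] suffices. *)
have expt t : expR t - 1 <= t * expR t :> R.
  have := expR_ge1Dx (- t); have := expR_gt0 t; have := expRxMexpNx_1 t.
  by move: (expR t) (expR (- t)) => x y; nra.
have tail t w (M : nat -> R) l : M = (fun n => mgf (mu n) (X n) t) ->
    (fun n : nat => n%:R^-1 * ln (M n)) @ \oo --> l -> l < t * w ->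
    (fun n => expR (n%:R * - (t * w)) * M n) @ \oo --> (0 : R).
  move=> ME Ml lw.
  have c0 : (fun n => expR (n%:R * (n%:R^-1 * ln (M n) - t * w))) @ \oo --> (0 : R).
    apply: (@cvg_expR_natmul _ _ (l - t * w)); first by rewrite subr_lt0.
    by apply: cvgB => //; exact: cvg_cst.
  apply: cvg_trans c0; apply: near_eq_cvg; near=> n.
  have n0 : (0 < n%:R :> R) by rewrite ltr0n; near: n; exact: nbhs_infty_gt.
  have Mn0 : 0 < M n by rewrite ME; near: n; exact: M0.
  rewrite -[in RHS](@lnK R (M n)) ?posrE // -expRD; congr expR.
  by field; rewrite gt_eqF.
have [b1 [b1a b11 b1r]] : exists b1, [/\ a < b1, b1 < 1 & `|a - b1| < r].
  exists (a + Num.min r (1 - a) / 2).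
  have m0 : 0 < Num.min r (1 - a) by rewrite lt_min r0; lra.
  have m1 : Num.min r (1 - a) <= r by rewrite ge_min lexx.
  have m2 : Num.min r (1 - a) <= 1 - a by rewrite ge_min lexx orbT.
  split; [lra | lra |].
  by rewrite distrC gtr0_norm; lra.
have [b2 [b2a b20 b2r]] : exists b2, [/\ b2 < a, 0 < b2 & `|a - b2| < r].
  exists (a - Num.min r a / 2).
  have m0 : 0 < Num.min r a by rewrite lt_min r0; lra.
  have m1 : Num.min r a <= r by rewrite ge_min lexx.
  have m2 : Num.min r a <= a by rewrite ge_min lexx orbT.
  split; [lra | lra |].
  by rewrite gtr0_norm; lra.
have t1 : 0 < slope b1 - slope a by rewrite subr_gt0 slope_lt.
have t2 : slope b2 - slope a < 0 by rewrite subr_lt0 slope_lt.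
have [|l1 c1 le1] := Hb b1; first by apply/andP; split; lra.
have [|l2 c2 le2] := Hb b2; first by apply/andP; split; lra.
have lt1 : l1 < (slope b1 - slope a) * (k + a + e).
  have := hbnd _ b1r; rewrite /h ltr_norml => /andP[h1 _].
  have := expt (slope b1 - slope a); move: t1 le1 h1.
  move: (slope b1 - slope a) => t; move: (expR t) => x t1 le1 h1 xt.
  have := ler_wpM2l k0 xt; nra.
have lt2 : l2 < (slope b2 - slope a) * (k + a - e).
  have := hbnd _ b2r; rewrite /h ltr_norml => /andP[_ h1].
  have := expt (slope b2 - slope a); move: t2 le2 h1.
  move: (slope b2 - slope a) => t; move: (expR t) => x t2 le2 h1 xt.
  have := ler_wpM2l k0 xt; nra.
have T1 := tail _ _ _ _ erefl c1 lt1.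
have T2 := tail _ _ _ _ erefl c2 lt2.
have T12 := cvgD T1 T2; rewrite addr0 in T12.
apply: (squeeze_cvgr _ (cvg_cst 0) (T12 _)); near=> n.
have n0 : (0 < n)%N by near: n; exact: nbhs_infty_gt.
have mun : forall G, 0 <= mu n G by near: n.
apply/andP; split; first by apply: sumr_ge0.
by apply: chernoff => //; exact: ltW.
Unshelve. all: by end_near. Qed.

(** * Exponential moments under the tilted law *)

Lemma mgf_V_T (R : realType) (lambda theta t : R) (n : nat) : (1 < n)%N ->
  mgf (@ERGM_law R lambda n (beta_ theta n)) (fun G => (V_T G)%:R) t =
  partition_fun n (lambda / n%:R) (expR (beta_ (theta + t) n * ln n%:R)) /
  partition_fun n (lambda / n%:R) (expR (beta_ theta n * ln n%:R)).
Proof.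
move=> n1; rewrite -(ZE lambda (beta_ theta n)) mulrC big_distrr; apply: eq_bigr => G _ /=.
rewrite /ERGM_law /tilt -!mulrA; congr (_ * _); rewrite mulrCA mulrC; congr (_ * _).
by rewrite -expRD -expRM_natr; congr expR; rewrite mulrA !beta_lnE //; ring.
Qed.

Lemma mgf_num_edges (R : realType) (lambda theta t : R) (n : nat) :
  0 < lambda -> lambda <= n%:R ->
  mgf (@ERGM_law R lambda n (beta_ theta n)) (fun G => (num_edges G)%:R) t =
  (1 + lambda * (expR t - 1) / n%:R) ^+ 'C(n, 2) *
  partition_fun n (lambda * expR t / (1 + lambda * (expR t - 1) / n%:R) / n%:R)
    (expR (beta_ theta n * ln n%:R)) /
  partition_fun n (lambda / n%:R) (expR (beta_ theta n * ln n%:R)).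
Proof.
move=> lam0 lamn; have N0 : 0 < n%:R :> R by apply: lt_le_trans lamn.
set p := lambda / n%:R; set u := expR t.
have qE : 1 - p + p * u = 1 + lambda * (u - 1) / n%:R by rewrite /p; ring.
have q0 : 0 < 1 - p + p * u.
  have p0 : 0 < p by rewrite divr_gt0.
  have p1 : p <= 1 by rewrite ler_pdivrMr // mul1r.
  by have := mulr_gt0 p0 (expR_gt0 t); rewrite -/u; lra.
have -> : lambda * u / (1 + lambda * (u - 1) / n%:R) / n%:R = p * u / (1 - p + p * u).
  by rewrite -qE -[lambda * u / _ / _]mulrAC -[lambda * u / n%:R]mulrAC.
rewrite -qE -[X in _ / X](ZE lambda (beta_ theta n)) /mgf.
rewrite (eq_bigr (fun G => (Z lambda n (beta_ theta n))^-1 * ((1 - p + p * u) ^+ 'C(n, 2) *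
  (expR (beta_ theta n * ln n%:R) ^+ V_T G * ER_law (p * u / (1 - p + p * u)) G)))).
  by rewrite -!big_distrr /= mulrC.
move=> G _; rewrite expRM_natr -/u /ERGM_law -/p /tilt [X in _ * X * _ * _]expRM_natr.
set c := Z _ _ _; set y := expR _.
transitivity (c^-1 * (y ^+ V_T G * (u ^+ num_edges G * ER_law p G))).
  by rewrite [u ^+ _ * _]mulrC !mulrA.
by rewrite ER_law_edge_tilt ?gt_eqF // [y ^+ _ * _]mulrCA.
Qed.

(** [x / (1 + x) <= ln (1 + x) <= x] at [x = c / n]. *)
Lemma cvg_edge_factor (R : realType) (c : R) :
  (fun n : nat => n%:R^-1 * ln ((1 + c / n%:R) ^+ 'C(n, 2))) @ \oo --> c / 2.
Proof.
have inv0 := @cvg_invn R.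
have c1 : (fun n : nat => c / 2 * (1 - n%:R^-1)) @ \oo --> c / 2 * (1 - 0).
  by apply: cvgMr; apply: cvgB => //; exact: cvg_cst.
have cq : (fun n : nat => 1 + c * n%:R^-1) @ \oo --> 1 + c * 0.
  by apply: cvgD; [exact: cvg_cst | exact: cvgMr].
have c2 : (fun n : nat => c / 2 * (1 - n%:R^-1) * (1 + c * n%:R^-1)^-1) @ \oo -->
    c / 2 * (1 - 0) * (1 + c * 0)^-1.
  by apply: cvgM => //; apply: cvgV => //; rewrite mulr0 addr0 oner_neq0.
rewrite mulr0 addr0 invr1 !subr0 !mulr1 in c1 cq c2.
apply: (squeeze_cvgr _ c2 c1); near=> n.
have n0 : (0 < n)%N by near: n; exact: nbhs_infty_gt.
have N1 : (1 <= n%:R :> R) by rewrite ler1n.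
have N0 : (0 < n%:R :> R) by rewrite ltr0n.
have q0 : 0 < 1 + c / n%:R by near: n; exact: (cvgr_gt 1).
have binE : 'C(n, 2)%:R = n%:R * (n%:R - 1) / 2 :> R.
  have := bin_ffact n 2; rewrite !ffactnS ffactn0 muln1 -subn1 => /(congr1 (fun k => k%:R : R)).
  by rewrite !natrM natrB // => <-; rewrite mulfK.
rewrite lnXn // -[ln _ *+ _]mulr_natl binE.
have -> : n%:R^-1 * (n%:R * (n%:R - 1) / 2 * ln (1 + c / n%:R)) =
    (n%:R - 1) / 2 * ln (1 + c / n%:R) by field; rewrite gt_eqF.
have h1 := xlnx_tangent (ltW q0) ltr01; have h2 := xlnx_tangent ler01 q0.
rewrite ln1 in h1 h2.
have nn : 0 <= (n%:R - 1) / 2 :> R by rewrite divr_ge0 // subr_ge0.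
have -> : c / 2 * (1 - n%:R^-1) = (n%:R - 1) / 2 * (c / n%:R) by field; rewrite gt_eqF.
rewrite -[(_ - 1) / 2 * _ * _]mulrA.
apply/andP; split; apply: ler_wpM2l => //; last by lra.
by rewrite ler_pdivrMr //; lra.
Unshelve. all: by end_near. Qed.

Lemma ln_div_partition_cvg (R : realType) (f g : nat -> R) (lf lg : R) :
  (\forall n \near \oo, 0 < f n) -> (\forall n \near \oo, 0 < g n) ->
  (fun n : nat => n%:R^-1 * ln (f n)) @ \oo --> lf ->
  (fun n : nat => n%:R^-1 * ln (g n)) @ \oo --> lg ->
  (fun n : nat => n%:R^-1 * ln (f n / g n)) @ \oo --> lf - lg.
Proof.
move=> f0 g0 cf cg; apply: cvg_trans (cvgB cf cg); apply: near_eq_cvg; near=> n.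
have fn : 0 < f n by near: n.
have gn : 0 < g n by near: n.
by rewrite ln_div ?posrE //= mulrBr.
Unshelve. all: by end_near. Qed.

Lemma near_partition_fun_gt0 (R : realType) (theta c : R) (p : nat -> R) :
  0 < c -> (fun n => n%:R * p n) @ \oo --> c ->
  \forall n \near \oo, 0 < partition_fun n (p n) (expR (beta_ theta n * ln n%:R)).
Proof.
move=> c0 pc; near=> n.
have yn : 1 <= expR (beta_ theta n * ln n%:R) :> R by near: n; exact: near_tilt_ge1.
have n0 : (0 < n%:R :> R) by rewrite ltr0n; near: n; exact: nbhs_infty_gt.
have np0 : 0 < n%:R * p n by near: n; exact: (cvgr_gt c).
have np : n%:R * p n < c + 1 by near: n; apply: (cvgr_lt c) => //; rewrite ltrDl.
have nc : c + 1 <= n%:R by near: n; exact: nbhs_infty_ger.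
have p0 : 0 <= p n by rewrite ltW // -(pmulr_rgt0 _ n0).
have p1 : p n <= 1 by rewrite -(ler_pM2l n0) mulr1; apply: le_trans nc; exact: ltW.
exact: lt_le_trans ltr01 (partition_fun_ge1 n p0 p1 yn).
Unshelve. all: by end_near. Qed.

Lemma cvg_mul_div_nat (R : realType) (c : R) :
  (fun n : nat => n%:R * (c / n%:R)) @ \oo --> c.
Proof.
apply: cvg_near_cst; near=> n.
have n0 : (0 < n%:R :> R) by rewrite ltr0n; near: n; exact: nbhs_infty_gt.
by rewrite mulrC divfK // gt_eqF.
Unshelve. all: by end_near. Qed.

Lemma near_ERGM_law_ge0 (R : realType) (lambda theta : R) : 0 < lambda ->
  \forall n \near \oo, forall G, 0 <= @ERGM_law R lambda n (beta_ theta n) G.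
Proof.
move=> lam0; near=> n => G.
have n0 : (0 < n%:R :> R) by rewrite ltr0n; near: n; exact: nbhs_infty_gt.
have pn : 0 <= lambda / n%:R <= 1.
  rewrite divr_ge0 ?(ltW lam0) ?(ltW n0) //= ler_pdivrMr // mul1r.
  by near: n; exact: nbhs_infty_ger.
have Zn : 0 < partition_fun n (lambda / n%:R) (expR (beta_ theta n * ln n%:R)).
  by near: n; apply: near_partition_fun_gt0 lam0 _; exact: cvg_mul_div_nat.
by rewrite /ERGM_law ZE !mulr_ge0 ?expR_ge0 ?ER_law_ge0 // invr_ge0 ltW.
Unshelve. all: by end_near. Qed.

Lemma near_mgf_ERGM_gt0 (R : realType) (lambda theta : R)
    (X : forall n, graph n -> R) (t : R) : 0 < lambda ->
  \forall n \near \oo, 0 < mgf (@ERGM_law R lambda n (beta_ theta n)) (X n) t.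
Proof.
move=> lam0; near=> n.
have mun : forall G, 0 <= @ERGM_law R lambda n (beta_ theta n) G.
  by near: n; exact: near_ERGM_law_ge0.
have Zn : 0 < partition_fun n (lambda / n%:R) (expR (beta_ theta n * ln n%:R)).
  by near: n; apply: near_partition_fun_gt0 lam0 _; exact: cvg_mul_div_nat.
rewrite lt_neqAle eq_sym sumr_ge0 ?andbT => [|G _]; last by rewrite mulr_ge0 ?expR_ge0.
apply/eqP => M0.
have E0 G : @ERGM_law R lambda n (beta_ theta n) G = 0.
  have F0 H : true -> 0 <= ERGM_law lambda (beta_ theta n) H * expR (t * X n H).
    by rewrite mulr_ge0 ?expR_ge0.
  by have /eqP := psumr_eq0P F0 M0 (erefl : xpredT G); rewrite mulf_eq0 expR_eq0 orbF => /eqP.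
have : \sum_(G : graph n) @ERGM_law R lambda n (beta_ theta n) G = 1.
  rewrite /ERGM_law; under eq_bigr do rewrite -mulrA.
  by rewrite -big_distrr /= mulVf // gt_eqF // ZE.
by rewrite big1 // => /esym/eqP; rewrite oner_eq0.
Unshelve. all: by end_near. Qed.

Lemma mgf_V_T_cvg (R : realType) (lambda theta a b : R) :
  0 < lambda -> 0 < a < 1 -> theta + ln lambda = slope a -> 0 < b < 1 ->
  (fun n : nat => n%:R^-1 * ln (mgf (@ERGM_law R lambda n (beta_ theta n))
     (fun G => (V_T G)%:R) (slope b - slope a))) @ \oo -->
  Lambda (theta + (slope b - slope a)) lambda b - Lambda theta lambda a.
Proof.
move=> lam0 a01 sa b01; set t := slope b - slope a.
have pc := @cvg_mul_div_nat R lambda.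
have ca := free_energy_cvg lam0 a01 sa pc.
have sb : theta + t + ln lambda = slope b by rewrite /t; lra.
have cb := free_energy_cvg lam0 b01 sb pc.
apply: cvg_trans (ln_div_partition_cvg (near_partition_fun_gt0 _ lam0 pc)
  (near_partition_fun_gt0 _ lam0 pc) cb ca).
apply: near_eq_cvg; near=> n; rewrite mgf_V_T //.
by near: n; exact: nbhs_infty_gt.
Unshelve. all: by end_near. Qed.

(** The first term comes from the normalization of the tilted edge weights, the
second one from the change of [lambda] into [lambda u]. *)
Lemma mgf_num_edges_cvg (R : realType) (lambda theta a b : R) :
  0 < lambda -> 0 < a < 1 -> theta + ln lambda = slope a -> 0 < b < 1 ->
  let u := expR (slope b - slope a) in
  (fun n : nat => n%:R^-1 * ln (mgf (@ERGM_law R lambda n (beta_ theta n))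
     (fun G => (num_edges G)%:R) (slope b - slope a))) @ \oo -->
  lambda * (u - 1) / 2 + (Lambda theta (lambda * u) b - Lambda theta lambda a).
Proof.
move=> lam0 a01 sa b01; set t := slope b - slope a => u.
have pc := @cvg_mul_div_nat R lambda.
have ca := free_energy_cvg lam0 a01 sa pc.
pose q n : R := 1 + lambda * (u - 1) / n%:R.
have qc : q @ \oo --> (1 : R).
  have : (fun n : nat => 1 + lambda * (u - 1) * n%:R^-1) @ \oo --> 1 + lambda * (u - 1) * 0.
    by apply: cvgD; [exact: cvg_cst | apply: cvgMr; exact: cvg_invn].
  by rewrite mulr0 addr0.
pose p' n : R := lambda * u / q n / n%:R.
have pc' : (fun n => n%:R * p' n) @ \oo --> lambda * u.
  have : (fun n => lambda * u * (q n)^-1) @ \oo --> lambda * u * 1^-1.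
    by apply: cvgMr; apply: cvgV => //; exact: oner_neq0.
  rewrite invr1 mulr1; apply: cvg_trans; apply: near_eq_cvg; near=> n.
  have n0 : (0 < n%:R :> R) by rewrite ltr0n; near: n; exact: nbhs_infty_gt.
  by rewrite /p' [RHS]mulrC divfK // gt_eqF.
have lu : 0 < lambda * u by rewrite mulr_gt0 ?expR_gt0.
have sb : theta + ln (lambda * u) = slope b.
  by rewrite lnM ?posrE ?expR_gt0 // expRK /t; lra.
have cb := free_energy_cvg lu b01 sb pc'.
have f0 := near_partition_fun_gt0 theta lu pc'.
have g0 := near_partition_fun_gt0 theta lam0 pc.
apply: cvg_trans (cvgD (@cvg_edge_factor R (lambda * (u - 1)))
  (ln_div_partition_cvg f0 g0 cb ca)).
apply: near_eq_cvg; near=> n.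
have f1 : 0 < partition_fun n (p' n) (expR (beta_ theta n * ln n%:R)) by near: n.
have g1 : 0 < partition_fun n (lambda / n%:R) (expR (beta_ theta n * ln n%:R)) by near: n.
have qn0 : 0 < q n by near: n; exact: (cvgr_gt 1).
have lamn : lambda <= n%:R by near: n; exact: nbhs_infty_ger.
rewrite mgf_num_edges // -[X in _ = _ * ln X]mulrA lnM ?posrE ?exprn_gt0 ?divr_gt0 //.
by rewrite [RHS]mulrDr.
Unshelve. all: by end_near. Qed.

Theorem theorem3p1 (R : realType) (lambda theta : R) (lambda_gt0 : 0 < lambda) :
  exists astar : R,
    [/\ is_maximizer `[0, 1] (Lambda theta lambda) astar,
        (forall b : R, is_maximizer `[0, 1] (Lambda theta lambda) b -> b = astar),
        (fun n : nat => n%:R^-1 * ln (Z lambda n (beta_ theta n))) @ \oo -->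
          Lambda theta lambda astar,
        cvg_in_prob (fun n => @ERGM_law R lambda n (beta_ theta n))
          (fun n G => (V_T G)%:R / n%:R) astar
      & cvg_in_prob (fun n => @ERGM_law R lambda n (beta_ theta n))
          (fun n G => (num_edges G)%:R / n%:R) (lambda / 2 + astar)].
Proof.
have [a a01 /esym sa] := slope_surj (theta + ln lambda); have /andP[a0 a1] := a01.
have gap b : 0 < b < 1 -> Lambda theta lambda b <= Lambda theta lambda a.
  by move=> /andP[b0 b1]; apply: Lambda_max => //; rewrite !ltW.
have law_ge0 := near_ERGM_law_ge0 theta lambda_gt0.
exists a; split.
- by split=> [|b]; rewrite /= in_itv /=; [rewrite !ltW | move=> b01; apply: Lambda_max].
- move=> b [/=]; rewrite in_itv /= => b01 /(_ a) bmax; apply/eqP; apply: contraT => ba.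
  have := Lambda_max_uniq a01 b01 sa ba; rewrite ltNge bmax //=.
  by rewrite in_itv /= !ltW.
- under eq_fun do rewrite ZE.
  exact: free_energy_cvg lambda_gt0 a01 sa (@cvg_mul_div_nat R lambda).
- rewrite -[a]add0r.
  apply: (@cvg_in_prob_of_mgf _ _ (fun n G => (V_T G)%:R)) => // [t|b b01].
    exact: near_mgf_ERGM_gt0.
  exists (Lambda (theta + (slope b - slope a)) lambda b - Lambda theta lambda a).
    exact: mgf_V_T_cvg.
  have := gap b b01; rewrite mul0r add0r (LambdaE (theta + _)) (LambdaE theta lambda b); lra.
- apply: (@cvg_in_prob_of_mgf _ _ (fun n G => (num_edges G)%:R)) => // [|t|b b01].
  + by rewrite divr_ge0 // ltW.
  + exact: near_mgf_ERGM_gt0.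
  exists (lambda * (expR (slope b - slope a) - 1) / 2 +
    (Lambda theta (lambda * expR (slope b - slope a)) b - Lambda theta lambda a)).
    exact: mgf_num_edges_cvg.
  have := gap b b01; rewrite (LambdaE theta lambda b) (LambdaE theta (lambda * _) b).
  by rewrite lnM ?posrE ?expR_gt0 // expRK; lra.
Qed.
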